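(* Let $(A,\mathfrak{m})$ be a Cohen–Macaulay local ring of dimension $d \geq 1$ with infinite residue field $k$, not regular, and of minimal multiplicity, i.e. $e_0(A) = h+1$ where $h = \operatorname{embdim}(A) - d$. For $g \in \mathfrak{m}^2 \setminus \mathfrak{m}^3$ whose initial form $g^*$ is a non-zero divisor in $\operatorname{gr} A$, let $\mathcal{B}_g$ be the class of maximal Cohen–Macaulay $A/(g)$-modules $M$ with $\operatorname{projdim}_A M < \infty$, and let $\mathcal{B}^{(2)} = \bigcup_g \mathcal{B}_g$, the union over all such $g$ (so $\deg g^* = 2$). Then for every $M \in \mathcal{B}^{(2)}$, $h+1$ divides $e_0(M)$.
   Context: $\operatorname{gr} A = \bigoplus_{n\geq 0} \mathfrak{m}^n/\mathfrak{m}^{n+1}$; for $0 \neq a \in \mathfrak{m}^i \setminus \mathfrak{m}^{i+1}$ its initial form $a^*$ is its image in $\mathfrak{m}^i/\mathfrak{m}^{i+1}$. For a finitely generated module $M$, its Hilbert series $\sum_{n\geq 0} \ell(\mathfrak{m}^nM/\mathfrak{m}^{n+1}M) z^n$ equals $h_M(z)/(1-z)^{\dim M}$ with $h_M(z) \in \mathbb{Z}[z]$, $h_M(1) \neq 0$, and the multiplicity is $e_0(M) = h_M(1)$. *)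

(* Defs.v *)
From HB Require Import structures.
From mathcomp Require Import all_boot all_algebra.
Set Implicit Arguments.
Unset Strict Implicit.
Unset Printing Implicit Defensive.
Import GRing.Theory.
Local Open Scope ring_scope.

Section CommAlg.
Variable R : comNzRingType.

Definition submodule (V : lmodType R) (N : V -> Prop) : Prop :=
  [/\ N 0, (forall u v, N u -> N v -> N (u + v)) & (forall (r : R) v, N v -> N (r *: v))].

Definition is_ideal (I : R -> Prop) : Prop := @submodule R^o I.

Definition span (V : lmodType R) (S : V -> Prop) : V -> Prop :=
  fun v => exists (k : nat) (c : 'I_k -> R) (s : 'I_k -> V),
    (forall i, S (s i)) /\ v = \sum_(i < k) c i *: s i.

Definition prodM (V : lmodType R) (I : R -> Prop) (N : V -> Prop) : V -> Prop :=
  span (fun v => exists r w, [/\ I r, N w & v = r *: w]).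

Fixpoint ipow (I : R -> Prop) (n : nat) : R -> Prop :=
  match n with
  | 0 => fun _ => True
  | n'.+1 => @prodM R^o I (ipow I n')
  end.

Definition powM (I : R -> Prop) (n : nat) (M : lmodType R) : M -> Prop :=
  prodM (ipow I n) (fun _ => True).
Arguments powM I n M : clear implicits.

Definition strict_incl (V : Type) (A B : V -> Prop) : Prop :=
  (forall v, A v -> B v) /\ exists v, B v /\ ~ A v.

Definition subchain (V : lmodType R) (N0 N1 : V -> Prop) (k : nat) : Prop :=
  exists C : nat -> V -> Prop,
    [/\ (forall v, C 0%N v <-> N0 v), (forall v, C k v <-> N1 v),
        (forall i, (i <= k)%N -> submodule (C i)) &
        (forall i, (i < k)%N -> strict_incl (C i) (C i.+1))].

(* qlength N0 N1 l : the length of the module N1/N0 is (finite and) equal to l *)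
Definition qlength (V : lmodType R) (N0 N1 : V -> Prop) (l : nat) : Prop :=
  subchain N0 N1 l /\ forall k, subchain N0 N1 k -> (k <= l)%N.

Definition prime_ideal (P : R -> Prop) : Prop :=
  [/\ is_ideal P, ~ P 1 & forall a b, P (a * b) -> P a \/ P b].

Definition prime_chain (I : R -> Prop) (k : nat) : Prop :=
  exists C : nat -> R -> Prop,
    (forall i, (i <= k)%N -> prime_ideal (C i) /\ (forall x, I x -> C i x)) /\
    (forall i, (i < k)%N -> strict_incl (C i) (C i.+1)).

(* kdim I n : the Krull dimension of R/I is (finite and) equal to n *)
Definition kdim (I : R -> Prop) (n : nat) : Prop :=
  prime_chain I n /\ forall k, prime_chain I k -> (k <= n)%N.

Definition ann (M : lmodType R) : R -> Prop := fun r => forall v : M, r *: v = 0.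

Definition mod_dim (M : lmodType R) (n : nat) : Prop := kdim (ann M) n.

Definition ring_dim (n : nat) : Prop := kdim (fun x => x = 0) n.

Definition principal (g : R) : R -> Prop := fun x => exists r, x = r * g.

Definition fin_gen (M : lmodType R) : Prop :=
  exists (k : nat) (s : 'I_k -> M), forall v, span (fun w => exists i, w = s i) v.

Definition noetherian : Prop :=
  forall I : R -> Prop, is_ideal I ->
    exists (k : nat) (s : 'I_k -> R),
      forall x, I x <-> @span R^o (fun w => exists i, w = s i) x.

Definition local_ring (m : R -> Prop) : Prop :=
  [/\ noetherian, is_ideal m, ~ m 1 & forall x, ~ m x -> exists y, x * y = 1].

Definition infinite_residue (m : R -> Prop) : Prop :=
  forall n : nat, exists f : 'I_n -> R, forall i j, m (f i - f j) -> i = j.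

(* embdim R = dim_k m/m^2 = length of the R-module m/m^2 *)
Definition embdim (m : R -> Prop) (e : nat) : Prop :=
  @qlength R^o (ipow m 2) (ipow m 1) e.

Definition seqM (M : lmodType R) (xs : seq R) (n : nat) : M -> Prop :=
  span (fun v => exists j w, (j < n)%N /\ v = xs`_j *: w).

Definition regular_seq (m : R -> Prop) (M : lmodType R) (xs : seq R) : Prop :=
  [/\ (forall x, x \in xs -> m x),
      (forall i, (i < size xs)%N -> forall v : M,
          seqM xs i (xs`_i *: v) -> seqM xs i v) &
      exists v : M, ~ seqM xs (size xs) v].

Definition depth (m : R -> Prop) (M : lmodType R) (t : nat) : Prop :=
  (exists xs, regular_seq m M xs /\ size xs = t) /\
  forall xs, regular_seq m M xs -> (size xs <= t)%N.

(* coefficient of z^j in 1/(1-z)^d *)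
Definition inv1mz_coef (d j : nat) : nat :=
  if d is d'.+1 then 'C(j + d', d') else (j == 0)%N : nat.

(* e_0(M) = e : the Hilbert series sum_n l(m^n M/m^(n+1) M) z^n equals
   h_M(z)/(1-z)^(dim M) with h_M in Z[z], h_M(1) <> 0, and e = h_M(1). *)
Definition multiplicity (m : R -> Prop) (M : lmodType R) (e : int) : Prop :=
  exists (dM : nat) (H : nat -> nat) (hM : {poly int}),
    [/\ mod_dim M dM,
        (forall n, qlength (powM m n.+1 M) (powM m n M) (H n)),
        (forall n, (H n)%:Z = \sum_(k < n.+1) hM`_k * (inv1mz_coef dM (n - k))%:Z),
        hM.[1] != 0 & e = hM.[1]].

Definition projective (P : lmodType R) : Prop :=
  forall (N N' : lmodType R) (f : {linear N -> N'}) (u : {linear P -> N'}),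
    (forall y : N', exists x : N, f x = y) ->
    exists w : {linear P -> N}, forall x, f (w x) = u x.

Definition finite_projdim (M : lmodType R) : Prop :=
  exists (n : nat) (P : nat -> lmodType R)
         (dd : forall i, {linear P i.+1 -> P i}) (eps : {linear P 0%N -> M}),
    [/\ (forall i, projective (P i)),
        (forall i, (n < i)%N -> forall x : P i, x = 0),
        (forall y : M, exists x, eps x = y),
        (forall x : P 0%N, eps x = 0 <-> exists y, dd 0%N y = x) &
        (forall i (x : P i.+1), dd i x = 0 <-> exists y, dd i.+1 y = x)].

(* the initial form g* of g is a non-zero divisor of gr_m(R) = (+)_i m^i/m^(i+1),
   g of initial degree s: multiplication by the homogeneous g* acts degreewise,
   so g* is a NZD iff for every i and c in m^i, g c in m^(i+s+1) implies
   c in m^(i+1) (i.e. g* c* = 0 in degree i+s forces c* = 0). *)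
Definition initial_form_nzd (m : R -> Prop) (g : R) (s : nat) : Prop :=
  forall (i : nat) (c : R), ipow m i c -> ipow m (i + s).+1 (g * c) -> ipow m i.+1 c.

Definition MCM_over_quotient (m : R -> Prop) (g : R) (M : lmodType R) : Prop :=
  [/\ (forall v : M, g *: v = 0), fin_gen M &
      exists t, kdim (principal g) t /\ depth m M t].

End CommAlg.
Arguments powM {R} I n M.

(* Main.v *)
From HB Require Import structures.
From mathcomp Require Import all_boot all_algebra.
From mathcomp Require Import boolp ring.
Require Import Defs.
Set Implicit Arguments.
Unset Strict Implicit.
Unset Printing Implicit Defensive.
Import GRing.Theory.
Local Open Scope ring_scope.

(** Since [depth M = depth A - 1], the minimal free resolution of [M] stops at
    [0 -> A^n --phi--> A^n -> M -> 0].  As [g] kills [M] and is a non-zero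
    divisor, there is [psi] with [phi psi = psi phi = g].  Row operations give
    weights [w_i] in [{1, 2}] such that row [i] of [phi] lies in [m^(w_i)] and
    column [i] of [psi] in [m^(2 - w_i)].  Because [g^*] is a non-zero divisor
    of degree [2], [v phi] in [m^k] then forces [v_i] in [m^(k - w_i)]: the
    initial form of [phi] is injective on [gr A], so the Hilbert series of [M]
    is [(sum_i (1 - z^(w_i))) H_A(z)] and [e_0(M) = e_0(A) * sum_i w_i].

    Quotient modules [V/N] are handled through the submodule [N] of [V].
    Depth is controlled by the exchange property: [depth V/(N + yV)] drops by at
    most one for a non-zero divisor [y] of [V/N].  It yields [dim A/(g) = d - 1]
    without Krull's principal ideal theorem, and regular sequences common to [A]
    and [M], modulo which the resolution stays exact. *)

(** The decisive point is strictness: multiplying [v phi] by [psi] returns [g v], and [g^*] can be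
    cancelled, so [phi] loses no order beyond the weights. Each length of [m^k M / m^(k+1) M] is
    thus computed exactly, with no Artin-Rees error term. Weights never exceed 2 because [g] lies in
    [m^2]: a row of weight 1 facing a unit of [psi] is traded for a multiple of some [g e_j].

    The multiplicity is read off from [1 - z^w = (1 - z)(1 + ... + z^(w-1))]: the factor [1 - z]
    lowers the pole order from [d] to [d - 1 = dim M], and the cofactor takes the value [w] at 1. As
    [M] is nonzero the sum of the weights is positive, so the numerator found is the true [h_M].

    An obstacle is that [finite_projdim] allows arbitrary projective modules. They are never shown
    to be free; comparing them with a minimal free resolution transfers only vanishing in high
    degree, and depth then pushes this vanishing down to degree 2. *)

Section Submodules.
Variable R : comNzRingType.
Implicit Types V W : lmodType R.

Lemma pred_ext (T : Type) (P Q : T -> Prop) : (forall x, P x <-> Q x) -> P = Q.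
Proof. by move=> PQ; apply/funext => x; apply/propext. Qed.

Lemma submodule_sum V (N : V -> Prop) (I : Type) (r : seq I) (P : pred I) F :
  submodule N -> (forall i, P i -> N (F i)) -> N (\sum_(i <- r | P i) F i).
Proof. by case=> N0 ND _ NF; apply: big_ind. Qed.

Lemma submoduleN V (N : V -> Prop) v : submodule N -> N v -> N (- v).
Proof. by case=> _ _ NZ /(NZ (-1)); rewrite scaleN1r. Qed.

Lemma submoduleB V (N : V -> Prop) u v : submodule N -> N u -> N v -> N (u - v).
Proof. by move=> sN Nu Nv; case: (sN) => _ ND _; apply: ND => //; exact: submoduleN. Qed.

Lemma submoduleDr V (N : V -> Prop) u v : submodule N -> N u -> N (u + v) -> N v.
Proof. by move=> sN Nu Nuv; rewrite -[v](addKr u) addrC; exact: submoduleB. Qed.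

Lemma submoduleT V : @submodule R V (fun _ => True).
Proof. by []. Qed.

Lemma submodule_eq0 V : @submodule R V (fun v => v = 0).
Proof. by split=> // [u v -> ->|r v ->]; rewrite ?addr0 ?scaler0. Qed.

Lemma submoduleI V (N N' : V -> Prop) :
  submodule N -> submodule N' -> submodule (fun v => N v /\ N' v).
Proof.
case=> N0 ND NZ [N0' ND' NZ']; split=> // [u v [? ?] [? ?]|r v [? ?]].
  by split; [exact: ND|exact: ND'].
by split; [exact: NZ|exact: NZ'].
Qed.

Definition sumS V (N N' : V -> Prop) : V -> Prop :=
  fun v => exists a b, [/\ N a, N' b & v = a + b].

Lemma submodule_sumS V (N N' : V -> Prop) :
  submodule N -> submodule N' -> submodule (sumS N N').
Proof.
case=> N0 ND NZ [N0' ND' NZ']; split.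
- by exists 0, 0; rewrite addr0.
- move=> _ _ [a [b [Na Nb ->]]] [a' [b' [Na' Nb' ->]]].
  by exists (a + a'), (b + b'); rewrite addrACA; split; [exact: ND|exact: ND'|].
- move=> r _ [a [b [Na Nb ->]]].
  by exists (r *: a), (r *: b); rewrite scalerDr; split; [exact: NZ|exact: NZ'|].
Qed.

Lemma sumSl V (N N' : V -> Prop) v : submodule N' -> N v -> sumS N N' v.
Proof. by case=> N0 _ _ Nv; exists v, 0; rewrite addr0. Qed.

Lemma sumSr V (N N' : V -> Prop) v : submodule N -> N' v -> sumS N N' v.
Proof. by case=> N0 _ _ Nv; exists 0, v; rewrite add0r. Qed.

Lemma span_incl V (S : V -> Prop) v : S v -> span S v.
Proof.
move=> Sv; exists 1%N, (fun=> 1), (fun=> v); split=> //.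
by rewrite big_ord1 scale1r.
Qed.

Lemma submodule_span V (S : V -> Prop) : submodule (span S).
Proof.
split.
- by exists 0%N, (fun=> 0), (fun=> 0); split=> [[]|] //; rewrite big_ord0.
- move=> _ _ [k [c [s [Ss ->]]]] [l [d [t [St ->]]]].
  exists (k + l)%N, (fun i => match split i with inl j => c j | inr j => d j end),
    (fun i => match split i with inl j => s j | inr j => t j end); split.
    by move=> i; case: (split i).
  rewrite big_split_ord /=; congr (_ + _); apply: eq_bigr => i _.
    by rewrite (unsplitK (inl i)).
  by rewrite (unsplitK (inr i)).
- move=> r _ [k [c [s [Ss ->]]]]; exists k, (fun i => r * c i), s; split=> //.
  by rewrite scaler_sumr; apply: eq_bigr => i _; rewrite scalerA.
Qed.

Lemma span_min V (S N : V -> Prop) :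
  submodule N -> (forall v, S v -> N v) -> forall v, span S v -> N v.
Proof.
move=> sN SN v [k [c [s [Ss ->]]]]; apply: submodule_sum => // i _.
by case: sN => _ _; apply; apply: SN.
Qed.

Lemma prodM_incl V (I : R -> Prop) (N : V -> Prop) r v :
  I r -> N v -> prodM I N (r *: v).
Proof. by move=> Ir Nv; apply: span_incl; exists r, v. Qed.

Lemma prodM_min V (I : R -> Prop) (N K : V -> Prop) :
  submodule K -> (forall r v, I r -> N v -> K (r *: v)) ->
  forall v, prodM I N v -> K v.
Proof. by move=> sK IK; apply: span_min => // _ [r [w [Ir Nw ->]]]; exact: IK. Qed.

Lemma prodM_subr V (I : R -> Prop) (N : V -> Prop) v :
  submodule N -> prodM I N v -> N v.
Proof. by move=> sN; apply: prodM_min => // r w _; case: sN => _ _; apply. Qed.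

Lemma idealD (I : R -> Prop) a b : is_ideal I -> I a -> I b -> I (a + b).
Proof. by case=> _ ID _; exact: ID. Qed.

Lemma idealMl (I : R -> Prop) a b : is_ideal I -> I b -> I (a * b).
Proof. by case=> _ _ IZ; exact: IZ. Qed.

Lemma idealMr (I : R -> Prop) a b : is_ideal I -> I a -> I (a * b).
Proof. by rewrite mulrC; exact: idealMl. Qed.

Lemma idealB (I : R -> Prop) a b : is_ideal I -> I a -> I b -> I (a - b).
Proof. exact: (@submoduleB R^o). Qed.

Lemma ideal_sum (I : R -> Prop) (J : Type) (r : seq J) (P : pred J) F :
  is_ideal I -> (forall i, P i -> I (F i)) -> I (\sum_(i <- r | P i) F i).
Proof. exact: (@submodule_sum R^o). Qed.

Lemma ipow_ideal (I : R -> Prop) n : is_ideal (ipow I n).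
Proof. by case: n => [|n]; [exact: submoduleT|exact: submodule_span]. Qed.

Lemma ipowS (I : R -> Prop) n x : ipow I n.+1 x -> ipow I n x.
Proof. by apply: prodM_subr; exact: ipow_ideal. Qed.

Lemma ipow_le (I : R -> Prop) n k x : (n <= k)%N -> ipow I k x -> ipow I n x.
Proof.
move=> /subnK <-; elim: (k - n)%N x => //= l IH x H.
by apply: IH; apply: (@ipowS I).
Qed.

Lemma ipow_mul (I : R -> Prop) a b x y :
  ipow I a x -> ipow I b y -> ipow I (a + b) (x * y).
Proof.
move=> + Hy; elim: a x => [|a IH] x Hx; first exact: idealMl (ipow_ideal _ _) Hy.
pose K : R^o -> Prop := fun x => ipow I (a.+1 + b) (x * y).
suff: K x by [].
have iI := ipow_ideal I (a.+1 + b).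
apply: prodM_min Hx => [|r v Ir Hv]; last first.
  by rewrite /K -[r *: v]/(r * v) -mulrA; exact: (@prodM_incl R^o) Ir (IH _ Hv).
split=> [|u v|r v]; rewrite /K ?mul0r ?mulrDl; first by case: iI.
  exact: idealD.
by rewrite -[r *: v]/(r * v) -mulrA; exact: idealMl.
Qed.

Lemma ipow1 (I : R -> Prop) x : is_ideal I -> ipow I 1 x <-> I x.
Proof.
move=> iI; split=> [|Ix]; first by apply: prodM_min => // r v Ir _; exact: idealMr.
by rewrite -[x]mulr1; exact: (@prodM_incl R^o).
Qed.

Lemma powM_regular (I : R -> Prop) n : powM I n R^o = ipow I n.
Proof.
apply: pred_ext => x; split=> [|Ix].
  by apply: prodM_min => [|r v Ir _]; [exact: ipow_ideal|exact: idealMr (ipow_ideal _ _) Ir].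
by rewrite -[x]mulr1; exact: (@prodM_incl R^o).
Qed.

Definition lincomb V n (s : 'I_n -> V) (v : 'rV[R]_n) : V := \sum_i v 0 i *: s i.

Fact lincomb_is_linear V n (s : 'I_n -> V) : linear (lincomb s).
Proof.
move=> a u v; rewrite /lincomb scaler_sumr -big_split /=; apply: eq_bigr => i _.
by rewrite !mxE scalerDl scalerA.
Qed.

HB.instance Definition _ V n (s : 'I_n -> V) :=
  GRing.isLinear.Build R 'rV[R]_n V _ (lincomb s) (lincomb_is_linear s).

Lemma lincomb_delta V n (s : 'I_n -> V) i : lincomb s (delta_mx 0 i) = s i.
Proof.
rewrite /lincomb (bigD1 i) //= big1 ?mxE ?eqxx ?scale1r ?addr0 // => j /negPf ji.
by rewrite mxE ji andbF scale0r.
Qed.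

Lemma span_lincomb V n (s : 'I_n -> V) v :
  span (fun w => exists i, w = s i) v <-> exists c, v = lincomb s c.
Proof.
split; last first.
  by case=> c ->; exists n, (fun i => c 0 i), s; split=> // i; exists i.
have sL : submodule (fun v : V => exists c, v = lincomb s c).
  split=> [|_ _ [c ->] [d ->]|r _ [c ->]]; first by exists 0; rewrite linear0.
    by exists (c + d); rewrite linearD.
  by exists (r *: c); rewrite linearZ.
by apply: (span_min sL) => _ [i ->]; exists (delta_mx 0 i); rewrite lincomb_delta.
Qed.

Lemma row_mul_eq n k (A : 'M[R]_(n, k)) (B : 'M[R]_(n, k)) :
  (forall v : 'rV_n, v *m A = v *m B) -> A = B.
Proof. by move=> AB; apply/row_matrixP => i; rewrite !rowE. Qed.

End Submodules.

(** * Finitely generated modules over a noetherian ring *)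

Section FinitelyGenerated.
Variable R : comNzRingType.
Implicit Types V W : lmodType R.

Definition sp V (l : seq V) : V -> Prop := span (fun w => w \in l).

Definition fg V (N : V -> Prop) : Prop := exists l : seq V, N = sp l.

Lemma submodule_sp V (l : seq V) : submodule (sp l).
Proof. exact: submodule_span. Qed.

Lemma sp_mem V (l : seq V) v : v \in l -> sp l v.
Proof. exact: span_incl. Qed.

Lemma sp_min V (l : seq V) (N : V -> Prop) :
  submodule N -> (forall v, v \in l -> N v) -> forall v, sp l v -> N v.
Proof. exact: span_min. Qed.

Lemma sp_sub V (l l' : seq V) v : {subset l <= l'} -> sp l v -> sp l' v.
Proof.
by move=> ll'; apply: sp_min => [|w /ll']; [exact: submodule_sp|exact: sp_mem].
Qed.

Lemma sp_nil V (v : V) : sp [::] v -> v = 0.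
Proof. by apply: (sp_min (submodule_eq0 V)). Qed.

Lemma sp_cons V a (l : seq V) v :
  sp (a :: l) v -> exists c w, sp l w /\ v = c *: a + w.
Proof.
have [l0 lD lZ] := submodule_sp l.
pose K (v : V) := exists c w, sp l w /\ v = c *: a + w.
have sK : submodule K.
  split=> [|_ _ [c [w [lw ->]]] [c' [w' [lw' ->]]]|r _ [c [w [lw ->]]]].
  - by exists 0, 0; rewrite scale0r addr0.
  - by exists (c + c'), (w + w'); rewrite scalerDl addrACA; split=> //; exact: lD.
  - by exists (r * c), (r *: w); rewrite scalerDr scalerA; split=> //; exact: lZ.
apply: (sp_min sK) => w; rewrite inE => /orP[/eqP ->|lw].
  by exists 1, 0; rewrite scale1r addr0.
by exists 0, w; rewrite scale0r add0r; split=> //; exact: sp_mem.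
Qed.

Lemma fin_gen_fg V : fin_gen V -> exists l : seq V, forall v, sp l v.
Proof.
case=> k [s Hs]; exists (codom s) => v; apply: span_min (Hs v).
  exact: submodule_sp.
by move=> _ [i ->]; apply/sp_mem/codom_f.
Qed.

Lemma noetherian_fg (I : R^o -> Prop) : noetherian R -> is_ideal I -> fg I.
Proof.
move=> noeR /noeR[k [s Hs]]; exists (codom s); apply: pred_ext => x.
rewrite Hs; split; apply: span_min; try exact: submodule_span.
  by move=> _ [i ->]; apply/sp_mem/codom_f.
by move=> _ /codomP[i ->]; apply: span_incl; exists i.
Qed.

(** Induction on the ambient generators: the coefficients of [a] occurring in [N] form a finitely
    generated ideal [I]. Lifting its generators into [N] by [U] reduces an element of [N] to one of
    [N] inside [sp l]. *)
Lemma fg_submodule V (l : seq V) (N : V -> Prop) :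
  noetherian R -> submodule N -> (forall v, N v -> sp l v) -> fg N.
Proof.
move=> noeR; elim: l N => [|a l IH] N sN Nl.
  exists [::]; apply: pred_ext => v; split=> [/Nl //|/sp_nil ->].
  by case: sN.
have [N0 ND NZ] := sN; have [l0 lD lZ] := submodule_sp l.
pose I : R^o -> Prop := fun c => exists u, N u /\ sp l (u - c *: a).
have iI : is_ideal I.
  split=> [|c c' [u [Nu lu]] [u' [Nu' lu']]|r c [u [Nu lu]]].
  - by exists 0; rewrite scale0r subr0.
  - exists (u + u'); split; first exact: ND.
    by rewrite scalerDl opprD addrACA; exact: lD.
  - exists (r *: u); split; first exact: NZ.
    by rewrite -scalerA -scalerBr; exact: lZ.
have [cs Ecs] := noetherian_fg noeR iI.
have /choice[U HU] : forall c : R, exists u, I c -> N u /\ sp l (u - c *: a).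
  move=> c; case: (EM (I c)) => [[u Hu]|nI]; first by exists u.
  by exists 0 => /nI.
have [|v []//|l' El'] := IH (fun v => N v /\ sp l v).
  exact/submoduleI/submodule_sp.
have HU' c : c \in cs -> N (U c) /\ sp l (U c - c *: a).
  by move=> ccs; apply: HU; rewrite Ecs; exact: sp_mem.
exists ([seq U c | c <- cs] ++ l'); apply: pred_ext => v; split; last first.
  apply: sp_min => // w; rewrite mem_cat => /orP[/mapP[c /HU'[Nc _] ->] //|].
  by move=> /sp_mem; rewrite -El' => -[].
move=> Nv; have /sp_cons[c [w [lw Ev]]] := Nl _ Nv.
have Ic : I c by exists v; split=> //; rewrite Ev addrC addKr.
pose K : R^o -> Prop := fun c => exists u, sp [seq U c | c <- cs] u /\ sp l (u - c *: a).
have [u0 uD uZ] := submodule_sp [seq U c | c <- cs].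
have sK : submodule K.
  split=> [|e e' [u [Nu lu]] [u' [Nu' lu']]|r e [u [Nu lu]]].
  - by exists 0; rewrite scale0r subr0.
  - exists (u + u'); split; first exact: uD.
    by rewrite scalerDl opprD addrACA; exact: lD.
  - exists (r *: u); split; first exact: uZ.
    by rewrite -scalerA -scalerBr; exact: lZ.
have [u [Uu lu]] : K c.
  rewrite Ecs in Ic; apply: sp_min Ic => // e ecs; exists (U e).
  by split; [apply/sp_mem/map_f|case: (HU' _ ecs)].
have Nu : N u by apply: sp_min Uu => // _ /mapP[e /HU'[Ne _] ->].
have [_ sD _] := submodule_sp ([seq U c | c <- cs] ++ l').
rewrite -(subrK u v) addrC; apply: sD.
  by apply: sp_sub Uu => x xU; rewrite mem_cat xU.
have: sp l' (v - u).
  rewrite -El'; split; first exact: submoduleB.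
  have -> : v - u = w - (u - c *: a) by rewrite Ev opprB addrA [w + _]addrC.
  by apply: submoduleB => //; exact: submodule_sp.
by apply: sp_sub => x xU; rewrite mem_cat xU orbT.
Qed.

(** Without a maximal member, iterating a choice function gives a strictly increasing chain, but the
    generators of its union already lie in one step. [nx] is total and constrained only on members
    of the family above [I0]. *)
Lemma noetherian_max (Fam : (R -> Prop) -> Prop) (I0 : R -> Prop) :
  noetherian R -> (forall I, Fam I -> is_ideal I) -> Fam I0 ->
  exists J, [/\ Fam J, forall x, I0 x -> J x &
    forall K, Fam K -> (forall x, J x -> K x) -> forall x, K x -> J x].
Proof.
move=> noeR FI F0; apply: contrapT => nex.
have /choice[nx Hnx] : forall J, exists K, Fam J -> (forall x, I0 x -> J x) ->
    [/\ Fam K, forall x, J x -> K x & exists x, K x /\ ~ J x].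
  move=> J; apply: contrapT => nK; apply: nex; exists J.
  have [FJ IJ] : Fam J /\ forall x, I0 x -> J x.
    split; apply: contrapT => nF; apply: nK; exists J => // FJ IJ; exact: nF.
  split=> // K FK JK x Kx; apply: contrapT => nJ; apply: nK; exists K => _ _.
  by split=> //; exists x.
pose C k := iter k nx I0.
have HC k : Fam (C k) /\ forall x, I0 x -> C k x.
  elim: k => [//|k [Fk Ik]]; have [FK JK _] := Hnx _ Fk Ik.
  by split=> // x /Ik /JK.
have HS k : (forall x, C k x -> C k.+1 x) /\ exists x, C k.+1 x /\ ~ C k x.
  by have [Fk Ik] := HC k; have [] := Hnx _ Fk Ik.
have Cle k k' x : (k <= k')%N -> C k x -> C k' x.
  move=> /subnK <-; elim: (k' - k)%N => // j IH /IH; exact: (HS _).1.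
have CI k : is_ideal (C k) := FI _ (HC k).1.
pose U : R^o -> Prop := fun x => exists k, C k x.
have iU : is_ideal U.
  split=> [|u v [k Ck] [k' Ck']|r v [k Ck]].
  - by exists 0%N; case: (CI 0%N).
  - exists (maxn k k'); apply: (idealD (CI _)); apply: Cle; try eassumption.
      exact: leq_maxl.
    exact: leq_maxr.
  - by exists k; exact: (idealMl _ (CI k)).
have [l El] := noetherian_fg noeR iU.
have [k Hk] : exists k, forall x, x \in l -> C k x.
  have: forall x, x \in l -> U x by move=> x xl; rewrite El; exact: sp_mem.
  elim: (l) => [|a l' IH] Hl; first by exists 0%N.
  have [k Hk] := Hl a (mem_head _ _).
  have [|k' Hk'] := IH; first by move=> x xl; apply: Hl; rewrite inE xl orbT.
  exists (maxn k k') => x; rewrite inE => /orP[/eqP ->|xl].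
    exact: Cle (leq_maxl _ _) Hk.
  exact: Cle (leq_maxr _ _) (Hk' _ xl).
have [_ [x [Cx []]]] := HS k.
have: U x by exists k.+1.
by rewrite El; apply: sp_min => //; exact: CI.
Qed.

End FinitelyGenerated.

(** * Nakayama's lemma and Krull's intersection theorem *)

Section LocalRing.
Variables (R : comNzRingType) (m : R -> Prop).
Hypothesis Hloc : local_ring m.
Implicit Types V W : lmodType R.

Lemma local_noetherian : noetherian R. Proof. by case: Hloc. Qed.
Lemma local_ideal : is_ideal m. Proof. by case: Hloc. Qed.
Lemma local_proper : ~ m 1. Proof. by case: Hloc. Qed.
Lemma local_unit x : ~ m x -> exists y, x * y = 1.
Proof. by case: Hloc => _ _ _; exact. Qed.
Let noeR := local_noetherian.
Let im := local_ideal.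

(** Generators are eliminated one by one instead of by a determinant: modulo [K = N + m (sp l)] the
    head satisfies [(1 - mu) a = 0] with [1 - mu] a unit, so [a] is in [K], and the tail then
    satisfies the same hypothesis without [a]. *)
Lemma nakayama V (N : V -> Prop) (l : seq V) :
  submodule N -> (forall a, a \in l -> sumS N (prodM m (sp l)) a) ->
  forall v, sp l v -> N v.
Proof.
move=> sN; elim: l => [|a l IH] Hl v; first by move=> /sp_nil ->; case: sN.
have [N0 ND NZ] := sN.
pose K := sumS N (prodM m (sp l)).
have sK : submodule K by apply: submodule_sumS => //; exact: submodule_span.
have [K0 KD KZ] := sK.
have dec w : sumS N (prodM m (sp (a :: l))) w -> exists mu, m mu /\ K (w - mu *: a).
  pose L (w : V) := exists mu, m mu /\ K (w - mu *: a).
  have sL : submodule L.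
    split=> [|u u' [mu [mm Ku]] [mu' [mm' Ku']]|r u [mu [mm Ku]]].
    - by exists 0; rewrite scale0r subr0; split=> //; case: im.
    - exists (mu + mu'); split; first exact: idealD.
      by rewrite scalerDl opprD addrACA; exact: KD.
    - exists (r * mu); split; first exact: idealMl.
      by rewrite -scalerA -scalerBr; exact: KZ.
  case=> n [b [Nn Hb ->]]; have [_ LD _] := sL; apply: LD.
    exists 0; rewrite scale0r subr0; split; first by case: im.
    by apply: sumSl => //; exact: submodule_span.
  apply: prodM_min Hb => // r u mr /sp_cons[c [u' [lu' ->]]].
  exists (r * c); split; first exact: idealMr.
  rewrite scalerDr scalerA addrAC subrr add0r.
  by apply: sumSr => //; exact: prodM_incl.
have Ka : K a.
  have [mu [mm Ka]] := dec _ (Hl a (mem_head _ _)).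
  have [|y Hy] := @local_unit (1 - mu).
    move=> m1; apply: local_proper; rewrite -(subrK mu 1); exact: idealD.
  by rewrite -[a]scale1r -Hy mulrC -scalerA scalerBl scale1r; exact: KZ.
have lN u : sp l u -> N u.
  apply: IH => b bl; have [|mu [mm Kb]] := dec b.
    by apply: Hl; rewrite inE bl orbT.
  by rewrite -(subrK (mu *: a) b); apply: KD => //; exact: KZ.
have Na : N a.
  have [n [b [Nn Hb ->]]] := Ka; apply: ND => //.
  by apply/lN; apply: prodM_subr Hb; exact: submodule_sp.
by move=> /sp_cons[c [w [/lN Nw ->]]]; apply: ND => //; exact: NZ.
Qed.

Lemma ipow_mono (I J : R -> Prop) n x :
  (forall y, I y -> J y) -> ipow I n x -> ipow J n x.
Proof.
move=> IJ; elim: n x => //= n IH x; apply: prodM_min; first exact: submodule_span.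
by move=> r v Ir Iv; apply: prodM_incl; [exact: IJ|exact: IH].
Qed.

Definition adjoin (I : R -> Prop) (a : R) : R -> Prop :=
  fun x => exists i r, I i /\ x = i + a * r.

Lemma adjoin_ideal I a : is_ideal I -> is_ideal (adjoin I a).
Proof.
move=> iI; split=> [|_ _ [i [r [Ii ->]]] [i' [r' [Ii' ->]]]|c _ [i [r [Ii ->]]]].
- by exists 0, 0; rewrite mulr0 addr0; split=> //; case: iI.
- by exists (i + i'), (r + r'); rewrite mulrDr addrACA; split=> //; exact: idealD.
- exists (c * i), (c * r); rewrite -[c *: _]/(c * _) mulrDr mulrCA.
  by split=> //; exact: idealMl.
Qed.

(** Pigeonhole on factors [i + a r]: after peeling one off, the [i] part uses the induction
    hypothesis at [(p, q + 1)] and the [a r] part at [(p + 1, q)]. *)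
Lemma ipow_adjoin I a n p q y : is_ideal I -> n = (p + q)%N ->
  ipow (adjoin I a) n y -> exists u r, ipow I p u /\ y = u + a ^+ q * r.
Proof.
move=> iI; elim: n p q y => [|n IH] p q y En.
  by case: p q En => [|p] [|q] //= _ _; exists y, 0; rewrite mulr0 addr0.
case: p En => [|p] En; first by exists y, 0; rewrite mulr0 addr0.
case: q En => [|q] En.
  exists 0, y; rewrite expr0 mul1r add0r; split=> //.
  by case: (ipow_ideal I p.+1).
pose K : R^o -> Prop := fun y => exists u r, ipow I p.+1 u /\ y = u + a ^+ q.+1 * r.
have iP := ipow_ideal I p.+1.
have sK : submodule K.
  split=> [|_ _ [i [r [Ii ->]]] [i' [r' [Ii' ->]]]|c _ [i [r [Ii ->]]]].
  - by exists 0, 0; rewrite mulr0 addr0; split=> //; case: iP.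
  - by exists (i + i'), (r + r'); rewrite mulrDr addrACA; split=> //; exact: idealD.
  - exists (c * i), (c * r); rewrite -[c *: _]/(c * _) mulrDr mulrCA.
    by split=> //; exact: idealMl.
apply: (prodM_min sK) => _ z [i [r [Ii ->]]] Hz.
have [u [s [Hu Ez]]] := IH p q.+1 z ltac:(by case: En) Hz.
have [u' [s' [Hu' Ez']]] := IH p.+1 q z ltac:(by rewrite addSnnS; case: En) Hz.
exists (i * u + a * r * u'), (i * s + r * s'); split.
  apply: (idealD iP); last exact: idealMl.
  exact: (@prodM_incl R R^o).
by rewrite -[_ *: _]/(_ * _) mulrDl {1}Ez Ez' exprS; ring.
Qed.

(* An ideal [K] maximal with [K] meeting [N = \bigcap m^n] inside [m N] contains a
   power of [m], so [N = m N]. *)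
Lemma krull_intersection c : (forall n, ipow m n c) -> c = 0.
Proof.
pose N : R^o -> Prop := fun x => forall n, ipow m n x.
have iN : is_ideal N.
  split=> [n|u v Nu Nv n|r v Nv n]; first by case: (ipow_ideal m n).
    exact: idealD (ipow_ideal m n) _ _.
  exact: idealMl (ipow_ideal m n) _.
pose mN := prodM m N.
have imN : is_ideal mN by exact: submodule_span.
pose Fam (K : R -> Prop) := is_ideal K /\ forall x, K x -> N x -> mN x.
have [||K [[iK KN] mNK Kmax]] := @noetherian_max R Fam mN noeR.
- by move=> I [].
- by split.
(* The ideals [K : x^j] stabilize. At such a [j], adjoining [x^j] to [K] keeps the intersection with
   [N] inside [m N], so maximality puts [x^j] in [K]. *)
have xK x : m x -> exists j, K (x ^+ j).
  move=> mx; pose C j : R -> Prop := fun r => K (x ^+ j * r).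
  have iC j : is_ideal (C j).
    split=> [|u v Ku Kv|r v Kv]; rewrite /C ?mulr0 ?mulrDr; first by case: iK.
      exact: idealD.
    by rewrite -[r *: v]/(r * v) mulrCA; exact: idealMl.
  have [||J [[j ->] _ Jmax]] := @noetherian_max R (fun J => exists j, J = C j) (C 0%N) noeR.
  - by move=> _ [j ->].
  - by exists 0%N.
  exists j; have CS r : K (x ^+ j.+1 * r) -> K (x ^+ j * r).
    apply: (Jmax (C j.+1)); first by exists j.+1.
    by move=> y Cy; rewrite /C exprS -mulrA; exact: idealMl.
  apply: (Kmax (adjoin K (x ^+ j))).
  - split; first exact: adjoin_ideal.
    move=> _ [i [r [Ki ->]]] Nir; apply: KN => //; apply: (idealD iK) => //.
    apply: CS; apply: (@submoduleDr R R^o K (x * i)) => //; first exact: idealMl.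
    rewrite exprS -mulrA -mulrDr; apply: mNK; exact: (@prodM_incl R R^o).
  - by move=> y Ky; exists y, 0; rewrite mulr0 addr0.
  - by exists 0, 1; rewrite mulr1 add0r; split=> //; case: iK.
(* Passing from powers of elements to a power of [m]: a maximal ideal of this family absorbs every
   [x] in [m], since some [x^j] is in [K]. *)
pose Fam' (J : R -> Prop) := is_ideal J /\ exists n, forall x, ipow J n x -> K x.
have [||J [[iJ [n Jn]] KJ Jmax]] := @noetherian_max R Fam' K noeR.
- by move=> I [].
- by split=> //; exists 1%N => x; rewrite ipow1.
have mJ x : m x -> J x.
  move=> mx; have [j Kj] := xK x mx.
  apply: (Jmax (adjoin J x)).
  - split; first exact: adjoin_ideal.
    exists (n + j)%N => y Hy; have [u [r [Hu ->]]] := ipow_adjoin iJ erefl Hy.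
    by apply: (idealD iK); [exact: Jn|exact: idealMr].
  - by move=> y Ky; exists y, 0; rewrite mulr0 addr0.
  - by exists 0, 1; rewrite mulr1 add0r; split=> //; case: iJ.
have NmN x : N x -> mN x.
  by move=> Nx; apply: KN => //; apply/Jn/(ipow_mono mJ)/Nx.
move=> Nc; have [l El] := noetherian_fg noeR iN.
apply: (nakayama (submodule_eq0 _) (l := l)); last by rewrite -El.
move=> a al; apply: sumSr; first exact: submodule_eq0.
by rewrite -El; apply: NmN; rewrite El; exact: sp_mem.
Qed.

End LocalRing.

(** * Regular sequences *)

Section Depth.
Variables (R : comNzRingType) (m : R -> Prop).
Hypothesis Hloc : local_ring m.
Implicit Types V W : lmodType R.
Let noeR := local_noetherian Hloc.
Let im := local_ideal Hloc.

Lemma prime_intersection (T : eqType) (l : seq T) (A : T -> R -> Prop) (P : R -> Prop) :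
  prime_ideal P -> (forall j, j \in l -> is_ideal (A j)) ->
  (forall x, (forall j, j \in l -> A j x) -> P x) ->
  exists2 j, j \in l & forall x, A j x -> P x.
Proof.
move=> [iP nP1 pP]; elim: l => [|a l IH] iA HP; first by case: nP1; exact: HP.
case: (EM (forall x, A a x -> P x)) => [aP|/existsNP[r /not_implyP[Ar nPr]]].
  by exists a => //; exact: mem_head.
have [||j jl jP] := IH.
- by move=> j jl; apply: iA; rewrite inE jl orbT.
- move=> x Hx; case: (pP r x) => // ; apply: HP => j; rewrite inE => /orP[/eqP ->|jl].
    by apply: idealMr => //; apply/iA/mem_head.
  by apply: idealMl; [apply: iA; rewrite inE jl orbT|exact: Hx].
- by exists j => //; rewrite inE jl orbT.
Qed.

(** A prime contained in the head is redundant and dropped. Otherwise some [y0] lies in all primes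
    of the tail but not in the head, and an [x] avoiding only the tail is corrected to
    [x + z * y0]. *)
Lemma prime_avoidance (T : eqType) (l : seq T) (A : T -> R -> Prop) (I : R -> Prop) :
  is_ideal I -> (forall j, j \in l -> prime_ideal (A j)) ->
  (forall j, j \in l -> exists2 x, I x & ~ A j x) ->
  exists2 x, I x & forall j, j \in l -> ~ A j x.
Proof.
move=> iI; have [k] := ubnP (size l); elim: k l => // k IH [|a l] sz pA nA.
  by exists 0 => //; case: iI.
have pA' j : j \in l -> prime_ideal (A j) by move=> jl; apply: pA; rewrite inE jl orbT.
have nA' j : j \in l -> exists2 x, I x & ~ A j x.
  by move=> jl; apply: nA; rewrite inE jl orbT.
have pa : prime_ideal (A a) by apply/pA/mem_head.
case: (EM (exists2 j, j \in l & forall x, A j x -> A a x)) => [[j jl ja]|inc].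
  have sub i : i \in a :: rem j l -> i \in a :: l.
    by rewrite !inE => /orP[->//|/mem_rem ->]; rewrite orbT.
  have [|i /sub /pA//|i /sub /nA//|x Ix Hx] := IH (a :: rem j l).
    by move: sz; rewrite /= size_rem // ltnS; case: (l) jl.
  exists x => // i; rewrite inE => /orP[/eqP ->|il]; first exact/Hx/mem_head.
  have [->|ij] := eqVneq i j; first by move=> /ja; apply/Hx/mem_head.
  by apply: Hx; rewrite inE (rem_mem ij il) orbT.
have [x Ix Hx] := IH l ltac:(by []) pA' nA'.
case: (EM (A a x)) => [ax|nax]; last first.
  by exists x => // j; rewrite inE => /orP[/eqP -> //|]; exact: Hx.
have [y0 [ly0 ny0]] : exists y, (forall j, j \in l -> A j y) /\ ~ A a y.
  apply: contrapT => ny; apply: inc; apply: prime_intersection => //.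
    by move=> j /pA'[].
  by move=> y Hy; apply: contrapT => nAy; apply: ny; exists y.
have [z Iz nz] := nA a (mem_head _ _).
exists (x + z * y0) => [|j]; first by apply: idealD => //; exact: idealMr.
rewrite inE => /orP[/eqP -> Axy|jl Axy].
  have : A a (z * y0) by case: (pa) => ia _ _; exact: (@submoduleDr R R^o) Axy.
  by case: pa => _ _ /[apply]; case.
case: (pA' j jl) => iA _ _; apply: (Hx j jl); rewrite -(addrK (z * y0) x).
by apply: idealB => //; exact: idealMl (ly0 _ jl).
Qed.

Definition nzdmod V (N : V -> Prop) (x : R) : Prop := forall v, N (x *: v) -> N v.

Definition nosocle V (N : V -> Prop) : Prop :=
  forall u, (forall r, m r -> N (r *: u)) -> N u.

Definition has_nzd V (N : V -> Prop) : Prop := exists2 x, m x & nzdmod N x.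

Lemma has_nzd_nosocle V (N : V -> Prop) : has_nzd N -> nosocle N.
Proof. by case=> x mx nx u /(_ x mx) /nx. Qed.

(** Lets finitely many generators be taken in [S] itself; this is what selects finitely many maximal
    annihilators below. *)
Lemma span_fg_gens V (S : V -> Prop) (l : seq V) : (forall v, v \in l -> span S v) ->
  exists2 l' : seq V, (forall v, v \in l' -> S v) & forall v, v \in l -> sp l' v.
Proof.
elim: l => [|a l IH] Hl; first by exists [::].
have [|l1 S1 H1] := IH; first by move=> v vl; apply: Hl; rewrite inE vl orbT.
have [k [c [s [Ss Ea]]]] := Hl a (mem_head _ _).
exists (codom s ++ l1) => v.
  by rewrite mem_cat => /orP[/codomP[i ->]|/S1].
rewrite inE => /orP[/eqP ->|/H1].
  rewrite Ea; apply: submodule_sum => [|i _]; first exact: submodule_sp.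
  have [_ _ spZ] := submodule_sp (codom s ++ l1); apply/spZ/sp_mem.
  by rewrite mem_cat codom_f.
by apply: sp_sub => x xl; rewrite mem_cat xl orbT.
Qed.

(* Only finitely many ideals are maximal among the annihilators [(N : u)], and
   they are prime; if their union covers [m], one of them is [m]. *)
Lemma nosocle_has_nzd V (N : V -> Prop) : fin_gen V -> submodule N ->
  nosocle N -> has_nzd N.
Proof.
move=> /fin_gen_fg[lV HV] sN nsN; have [N0 ND NZ] := sN.
pose A u : R -> Prop := fun r => N (r *: u).
have iA u : is_ideal (A u).
  split=> [|r r' Nr Nr'|c r Nr]; rewrite /A ?scale0r ?scalerDl //; first exact: ND.
  by rewrite -[c *: r]/(c * r) -scalerA; exact: NZ.
pose S u := ~ N u /\ forall u', ~ N u' -> (forall r, A u r -> A u' r) ->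
   forall r, A u' r -> A u r.
have pS u : S u -> prime_ideal (A u).
  case=> nu Su; split=> //; first by rewrite /A scale1r.
  move=> a b Aab; case: (EM (A u b)) => [|nb]; [by right|left].
  apply: (Su (b *: u) nb); last by rewrite /A scalerA.
  by move=> r Ar; rewrite /A scalerA mulrC -scalerA; exact: NZ.
have exS v : ~ N v -> exists2 u, S u & forall r, A v r -> A u r.
  move=> nv.
  have [||J [[u nu ->] vJ Jmax]] :=
    @noetherian_max R (fun J => exists2 u, ~ N u & J = A u) (A v) noeR.
  - by move=> _ [u _ ->].
  - by exists v.
  exists u => //; split=> // u' nu' uu'; apply: (Jmax (A u')) => //; by exists u'.
have [l El] : fg (span S).
  by apply: (@fg_submodule _ _ lV) => //; exact: submodule_span.
have [|l' S' H'] := @span_fg_gens V S l; first by move=> v vl; rewrite El; exact: sp_mem.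
(* As [u] is a combination of [l'], the prime [A u] contains the intersection of the [A j], hence
   one of them; maximality of [A j] makes them equal. *)
have cov u : S u -> exists2 j, j \in l' & forall r, A u r <-> A j r.
  move=> Su; have [|j jl jA] := @prime_intersection V l' A (A u) (pS _ Su) (fun j _ => iA j).
    move=> x Hx; have: sp l' u.
      apply: (@sp_min _ _ l); [exact: submodule_sp|exact: H'|rewrite -El; exact: span_incl].
    pose K v := N (x *: v).
    apply: (@sp_min _ _ l' K) => //; split; rewrite /K => *; rewrite ?scaler0 ?scalerDr //.
      exact: ND.
    by rewrite scalerA mulrC -scalerA; exact: NZ.
  exists j => // r; split; last exact: jA.
  by case: (S' _ jl) => _; apply=> //; case: Su.
apply: contrapT => nn.
have [||x mx Hx] := @prime_avoidance V l' A m im.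
- by move=> j /S' /pS.
- move=> j /S'[nj _]; apply: contrapT => ne; apply: nj; apply: nsN => r mr.
  by apply: contrapT => nr; apply: ne; exists r.
apply: nn; exists x => // v Nxv; apply: contrapT => /exS[u Su vu].
by have [j jl uj] := cov u Su; apply: (Hx j jl); apply/uj/vu.
Qed.

Definition prodS V W (N : V -> Prop) (N' : W -> Prop) : V * W -> Prop :=
  fun p => N p.1 /\ N' p.2.

Lemma submodule_prodS V W (N : V -> Prop) (N' : W -> Prop) :
  submodule N -> submodule N' -> submodule (prodS N N').
Proof.
case=> N0 ND NZ [N0' ND' NZ']; split=> // [u v [? ?] [? ?]|r v [? ?]].
  by split; [exact: ND|exact: ND'].
by split; [exact: NZ|exact: NZ'].
Qed.

Lemma fin_gen_prod V W : fin_gen V -> fin_gen W -> fin_gen (V * W)%type.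
Proof.
move=> [k [s Hs]] [l [t Ht]].
pose f (i : 'I_(k + l)) : V * W :=
  match split i with inl j => (s j, 0) | inr j => (0, t j) end.
exists (k + l)%N, f => -[v w].
have [S0 SD SZ] := submodule_span (fun x => exists i, x = f i).
have -> : (v, w) = (v, 0) + (0, w) by apply/eqP; rewrite -pair_eqE /= addr0 add0r !eqxx.
apply: (SD).
- pose K (v : V) := span (fun x => exists i, x = f i) (v, 0 : W).
  apply: (@span_min _ _ _ K _ _ v (Hs v)) => [|_ [i ->]].
    split=> [//|x y Kx Ky|r x Kx]; rewrite /K.
      by have := SD _ _ Kx Ky; rewrite -[X in span _ X]/(x + y, 0 + 0) addr0.
    by have := SZ r _ Kx; rewrite -[X in span _ X]/(r *: x, r *: 0) scaler0.
  by apply: span_incl; exists (lshift l i); rewrite /f (unsplitK (inl i)).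
- pose K (w : W) := span (fun x => exists i, x = f i) (0 : V, w).
  apply: (@span_min _ _ _ K _ _ w (Ht w)) => [|_ [i ->]].
    split=> [//|x y Kx Ky|r x Kx]; rewrite /K.
      by have := SD _ _ Kx Ky; rewrite -[X in span _ X]/(0 + 0, x + y) addr0.
    by have := SZ r _ Kx; rewrite -[X in span _ X]/(r *: 0, r *: x) scaler0.
  by apply: span_incl; exists (rshift k i); rewrite /f (unsplitK (inr i)).
Qed.

(** An element regular on a direct sum is regular on both summands, so one application to [V * W]
    suffices. *)
Lemma common_nzd V W (N : V -> Prop) (N' : W -> Prop) :
  fin_gen V -> fin_gen W -> submodule N -> submodule N' ->
  nosocle N -> nosocle N' -> exists x, [/\ m x, nzdmod N x & nzdmod N' x].
Proof.
move=> fV fW sN sN' nN nN'.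
have [||[u u'] H|x mx Hx] := @nosocle_has_nzd _ (prodS N N').
- exact: fin_gen_prod.
- exact: submodule_prodS.
- by split; [apply: nN => r /H []|apply: nN' => r /H []].
have [[N0 _ _] [N0' _ _]] := (sN, sN').
exists x; split=> // v Nv; [case: (Hx (v, 0)) => //|case: (Hx (0, v)) => //].
  by split=> //=; rewrite scaler0.
by split=> //=; rewrite scaler0.
Qed.

Definition addx V (N : V -> Prop) (x : R) : V -> Prop :=
  fun v => exists n w, N n /\ v = n + x *: w.

Lemma submodule_addx V (N : V -> Prop) x : submodule N -> submodule (addx N x).
Proof.
case=> N0 ND NZ; split.
- by exists 0, 0; rewrite scaler0 addr0.
- move=> _ _ [n [w [Nn ->]]] [n' [w' [Nn' ->]]]; exists (n + n'), (w + w').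
  by rewrite scalerDr addrACA; split=> //; exact: ND.
- move=> r _ [n [w [Nn ->]]]; exists (r *: n), (r *: w).
  by rewrite scalerDr !scalerA mulrC; split=> //; exact: NZ.
Qed.

Lemma addx_sub V (N : V -> Prop) x v : N v -> addx N x v.
Proof. by move=> Nv; exists v, 0; rewrite scaler0 addr0. Qed.

Lemma addx_scale V (N : V -> Prop) x v : submodule N -> addx N x (x *: v).
Proof. by case=> N0 _ _; exists 0, v; rewrite add0r. Qed.

Lemma addxC V (N : V -> Prop) x y : addx (addx N x) y = addx (addx N y) x.
Proof.
apply: pred_ext => v; split=> -[_ [w [[n [w' [Nn ->]]] ->]]].
  by exists (n + y *: w), w'; rewrite addrAC; split=> //; exists n, w.
by exists (n + x *: w), w'; rewrite addrAC; split=> //; exists n, w.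
Qed.

Lemma addx_proper V (N : V -> Prop) y : fin_gen V -> submodule N -> m y ->
  (exists v, ~ N v) -> exists v, ~ addx N y v.
Proof.
move=> /fin_gen_fg[l Hl] sN my [v nv]; apply: contrapT => ne; apply: nv.
apply: (nakayama Hloc sN (l := l)) => // a _.
have [n [w [Nn ->]]] : addx N y a by apply: contrapT => na; apply: ne; exists a.
by exists n, (y *: w); split=> //; apply: prodM_incl.
Qed.

(** The half of permuting a regular sequence that needs no Nakayama: in [x u = n + z v], regularity
    of [z] gives [v = n' + x w], and then [x] can be cancelled from [x (u - z w)]. *)
Lemma nzdmod_swap V (N : V -> Prop) x z : submodule N ->
  nzdmod N x -> nzdmod (addx N x) z -> nzdmod (addx N z) x.
Proof.
move=> sN nx nxz u [n [v [Nn Eu]]]; have [N0 ND NZ] := sN.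
have [n' [w [Nn' Ev]]] : addx N x v.
  apply: nxz; exists (- n), u; split; first exact: submoduleN.
  by rewrite Eu addKr.
exists (u - z *: w), w; rewrite subrK; split=> //; apply: nx.
have -> : x *: (u - z *: w) = n + z *: n'; last by apply: ND => //; exact: NZ.
by rewrite scalerBr Eu Ev scalerDr !scalerA [z * x]mulrC addrA addrK.
Qed.

(* A socle element [u] modulo [N + xV] gives the socle element [v] modulo
   [N + yV] with [y u = x v] modulo [N]. *)
Lemma nosocle_swap V (N : V -> Prop) x y : submodule N -> m y ->
  nzdmod N x -> nzdmod N y -> nosocle (addx N y) -> nosocle (addx N x).
Proof.
move=> sN my nx ny nsy u Hu; have [N0 ND NZ] := sN.
have [n [v [Nn Eyu]]] := Hu y my.
have [|n' [w [Nn' Ev]]] := nsy v.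
  move=> r mr; have [n' [w [Nn' Eru]]] := Hu r mr.
  exists (r *: v - y *: w), w; rewrite subrK; split=> //; apply: nx.
  have -> : x *: (r *: v - y *: w) = y *: n' - r *: n.
    rewrite scalerBr !scalerA [x * r]mulrC [x * y]mulrC -!scalerA.
    have -> : x *: v = y *: u - n by rewrite Eyu addrC addKr.
    have -> : x *: w = r *: u - n' by rewrite Eru addrC addKr.
    by rewrite !scalerBr !scalerA [r * y]mulrC opprB addrC addrA subrK.
  by apply: submoduleB => //; exact: NZ.
exists (u - x *: w), w; rewrite subrK; split=> //; apply: ny.
have -> : y *: (u - x *: w) = n + x *: n'; last by apply: ND => //; exact: NZ.
by rewrite scalerBr Eyu Ev scalerDr !scalerA [y * x]mulrC addrA addrK.
Qed.

(** Recursive form of [regular_seq], relative to [N], so that inductions on depth can peel off the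
    first element; [regular_seqE] gives the equivalence for [N = 0]. *)
Fixpoint regl V (N : V -> Prop) (xs : seq R) : Prop :=
  if xs is x :: xs' then [/\ m x, nzdmod N x & regl (addx N x) xs'] else exists v, ~ N v.

(* [dge N t] means [depth V/N >= t]. *)
Definition dge V (N : V -> Prop) (t : nat) : Prop := exists2 xs, size xs = t & regl N xs.

Lemma dge0 V (N : V -> Prop) : dge N 0 <-> exists v, ~ N v.
Proof. by split=> [[[|//] _ ]|]; [|exists [::]]. Qed.

Lemma dgeS V (N : V -> Prop) t :
  dge N t.+1 <-> exists x, [/\ m x, nzdmod N x & dge (addx N x) t].
Proof.
split=> [[[|x xs] //= [sz] [mx nx rx]]|[x [mx nx [xs sz rx]]]].
  by exists x; split=> //; exists xs.
by exists (x :: xs) => //=; rewrite sz.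
Qed.

Lemma dge_has_nzd V (N : V -> Prop) t : dge N t.+1 -> has_nzd N.
Proof. by move=> /dgeS[x [mx nx _]]; exists x. Qed.

Lemma dge_proper V (N : V -> Prop) t : dge N t -> exists v, ~ N v.
Proof.
elim: t N => [|t IH] N; first by move=> /dge0.
by move=> /dgeS[x [_ _ /IH[v nv]]]; exists v => /(addx_sub x).
Qed.

(* Pass through a [z] that is regular modulo [N], [N + xV] and [N + yV]. *)
Lemma dge_exchange V (N : V -> Prop) t y : fin_gen V -> submodule N -> m y ->
  nzdmod N y -> dge N t.+1 -> dge (addx N y) t.
Proof.
move=> fV; elim: t N y => [|t IH] N y sN my ny dN.
  by apply/dge0/addx_proper => //; exact: dge_proper dN.
have /dgeS[x [mx nx dx]] := dN.
have sx := submodule_addx x sN; have sy := submodule_addx y sN.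
have nsx := has_nzd_nosocle (dge_has_nzd dx).
have nsy := nosocle_swap sN mx ny nx nsx.
have nsN : nosocle N by apply: has_nzd_nosocle; exists x.
have [|||[u u'] H|z [mz nz nzxy]] :=
  @common_nzd V (V * V)%type N (prodS (addx N x) (addx N y)) fV (fin_gen_prod fV fV) => //.
- exact: submodule_prodS.
- by split; [apply: nsx => r /H []|apply: nsy => r /H []].
have nzx : nzdmod (addx N x) z.
  by move=> v Nv; case: (nzxy (v, 0)) => //; split=> //=; rewrite scaler0; case: sy.
have nzy : nzdmod (addx N y) z.
  by move=> v Nv; case: (nzxy (0, v)) => //; split=> //=; rewrite scaler0; case: sx.
(* The induction hypothesis is used twice: cutting [V/(N + xV)] by [z] shows that [V/(N + zV)] keeps
   depth [t + 1], and cutting the latter by [y] then leaves depth [t], to which [z] is added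
   back. *)
have dxz := IH _ z sx mz nzx dx; rewrite addxC in dxz.
have dz : dge (addx N z) t.+1.
  by apply/dgeS; exists x; split=> //; exact: nzdmod_swap.
apply/dgeS; exists z; split=> //; rewrite addxC.
by apply: IH => //; [exact: submodule_addx|exact: nzdmod_swap].
Qed.

Lemma seqMS V (xs : seq R) n : @seqM R V xs n.+1 = addx (seqM xs n) xs`_n.
Proof.
have sn : submodule (@seqM R V xs n) by exact: submodule_span.
apply: pred_ext => v; split.
  apply: span_min; first exact: submodule_addx.
  move=> _ [j [w [jn ->]]]; move: jn; rewrite ltnS leq_eqVlt => /orP[/eqP ->|jn].
    exact: addx_scale.
  by apply: addx_sub; apply: span_incl; exists j, w.
have [_ sD _] : submodule (@seqM R V xs n.+1) by exact: submodule_span.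
case=> a [w [Ha ->]]; apply: sD; last by apply: span_incl; exists n, w.
apply: span_min Ha; first exact: submodule_span.
by move=> _ [j [u [jn ->]]]; apply: span_incl; exists j, u; split=> //; exact: ltnW.
Qed.

Lemma seqM_foldl V (xs : seq R) n : (n <= size xs)%N ->
  @seqM R V xs n = foldl (@addx V) (fun v => v = 0) (take n xs).
Proof.
elim: n => [_|n IH nxs].
  rewrite take0 /=; apply: pred_ext => v; split; last first.
    by move=> ->; case: (@submodule_span R V (fun v => exists j w, (j < 0)%N /\ v = xs`_j *: w)).
  by apply: (span_min (submodule_eq0 _)) => _ [j [w [//]]].
by rewrite seqMS (take_nth 0) // foldl_rcons -IH // ltnW.
Qed.

Lemma regl_foldl V (N : V -> Prop) (xs : seq R) : regl N xs <->
  [/\ forall x, x \in xs -> m x,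
      forall i, (i < size xs)%N -> nzdmod (foldl (@addx V) N (take i xs)) xs`_i &
      exists v, ~ foldl (@addx V) N xs v].
Proof.
elim: xs N => [|x xs IH] N /=; first by split=> [|[]].
split=> [[mx nx /IH[mxs nxs ex]]|[mxs nxs ex]].
  split=> // [y|[|i]]; rewrite ?inE //; last exact: nxs.
  by move=> /orP[/eqP ->|/mxs].
split; [exact/mxs/mem_head|exact: (nxs 0%N)|apply/IH; split=> // [y yx|i ixs]].
  by apply: mxs; rewrite inE yx orbT.
exact: (nxs i.+1).
Qed.

Lemma regular_seqE V (xs : seq R) :
  @regular_seq R m V xs <-> regl (fun v : V => v = 0) xs.
Proof.
rewrite regl_foldl /regular_seq; have := @seqM_foldl V xs _ (leqnn _).
rewrite take_size => <-.
by split=> -[? H ?]; split=> // i ixs; [rewrite -seqM_foldl 1?ltnW|rewrite seqM_foldl 1?ltnW] => //; exact: H.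
Qed.

Lemma depth_dge V t : depth m V t -> dge (fun v : V => v = 0) t.
Proof. by case=> -[xs [/regular_seqE rx sz]] _; exists xs. Qed.

Lemma depth_dge_max V t k : depth m V t -> dge (fun v : V => v = 0) k -> (k <= t)%N.
Proof. by case=> _ Hmax [xs <- /regular_seqE]; exact: Hmax. Qed.

(** The annihilator of [V/N], through which the dimension of the quotient is read. *)
Definition colon V (N : V -> Prop) : R -> Prop := fun r => forall v, N (r *: v).

Lemma colon_ideal V (N : V -> Prop) : submodule N -> is_ideal (colon N).
Proof.
case=> N0 ND NZ; split=> [v|r s Nr Ns v|r s Ns v]; rewrite ?scale0r // ?scalerDl.
  exact: ND.
by rewrite -[r *: s]/(r * s) -scalerA; exact: NZ.
Qed.

(** An ideal maximal among those containing [I] and missing [S] is prime; noetherianity supplies it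
    instead of Zorn's lemma. *)
Lemma prime_disjoint (I S : R -> Prop) : is_ideal I -> S 1 ->
  (forall a b, S a -> S b -> S (a * b)) -> (forall x, I x -> ~ S x) ->
  exists Q, [/\ prime_ideal Q, forall x, I x -> Q x & forall x, Q x -> ~ S x].
Proof.
move=> iI S1 SM IS.
have [||Q [[iQ QS] IQ Qmax]] :=
  @noetherian_max R (fun J => is_ideal J /\ forall x, J x -> ~ S x) I noeR.
- by move=> J [].
- by [].
exists Q; split=> //; split=> // [Q1|a b Qab]; first exact: (QS 1).
have meet c : ~ Q c -> exists q r, Q q /\ S (q + c * r).
  move=> nc; apply: contrapT => ne; apply: nc; apply: (Qmax (adjoin Q c)).
  - split; first exact: adjoin_ideal.
    by move=> _ [q [r [Qq ->]]] Sx; apply: ne; exists q, r.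
  - by move=> x Qx; exists x, 0; rewrite mulr0 addr0.
  - by exists 0, 1; rewrite mulr1 add0r; split=> //; case: iQ.
apply: contrapT => /not_orP[/meet[q [r [Qq Sq]]] /meet[q' [r' [Qq' Sq']]]].
apply: (QS _ _ (SM _ _ Sq Sq')).
have -> : (q + a * r) * (q' + b * r') =
  q * (q' + b * r') + (a * r * q' + a * b * (r * r')) by ring.
by apply: idealD => //; [exact: idealMr|apply: idealD => //; [exact: idealMl|exact: idealMr]].
Qed.

(* The new prime avoids the elements [s x^n] with [s] outside the smallest prime
   of the given chain. *)
Lemma prime_chain_below V (N : V -> Prop) x t : submodule N -> nzdmod N x ->
  prime_chain (colon (addx N x)) t -> prime_chain (colon N) t.+1.
Proof.
move=> sN nx [C [HC SC]]; have [[iP P1 pP] cP] := HC 0%N (leq0n _).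
have colonS r : colon N r -> colon (addx N x) r by move=> Nr v; apply/addx_sub/Nr.
pose S r := exists s n, ~ C 0%N s /\ r = s * x ^+ n.
have [|||Q [pQ NQ QS]] := @prime_disjoint (colon N) S (colon_ideal sN).
- by exists 1, 0%N; rewrite mul1r.
- move=> _ _ [s [n [Cs ->]]] [s' [n' [Cs' ->]]]; exists (s * s'), (n + n')%N.
  by split; [move=> /pP[]|rewrite exprD mulrACA].
(* If [s x^n] annihilates [V/N], then so does [s], by cancelling [x]; this forces [s] into the
   smallest prime of the chain. *)
- move=> r Nr [s [n [Cs Er]]]; subst r; apply: Cs; apply/cP/colonS => v.
  have := Nr v; rewrite mulrC -scalerA {Nr}; elim: n => [|n IH]; first by rewrite expr0 scale1r.
  by rewrite exprS -scalerA => /nx.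
exists (fun i => if i is i'.+1 then C i' else Q); split.
  move=> [_|i]; first by split.
  by rewrite ltnS => /HC[pC cC]; split=> // r /colonS /cC.
move=> [_|i]; last exact: SC.
split=> [r Qr|].
  by apply: contrapT => Cr; apply: (QS _ Qr); exists r, 0%N; rewrite mulr1.
exists x; split; first by apply: cP => v; exact: addx_scale.
by move=> Qx; apply: (QS _ Qx); exists 1, 1%N; rewrite mul1r.
Qed.

Lemma max_prime : prime_ideal m.
Proof.
split=> //; first exact: local_proper Hloc.
move=> a b mab; case: (EM (m a)) => [|/(local_unit Hloc)[y ay]]; [by left|right].
by rewrite -[b]mul1r -ay mulrAC; exact: idealMr.
Qed.

(** Depth bounds dimension from below: the chain starts at [m], and each element of the regular
    sequence, taken from the last to the first, adds a prime at the bottom. *)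
Lemma dge_prime_chain V (N : V -> Prop) t : submodule N -> dge N t ->
  prime_chain (colon N) t.
Proof.
elim: t N => [|t IH] N sN.
  move=> /dge0[v nv]; exists (fun=> m); split=> // _ _; split; first exact: max_prime.
  move=> r Nr; apply: contrapT => /(local_unit Hloc)[y ry]; apply: nv.
  by rewrite -[v]scale1r -ry -scalerA; exact: Nr.
move=> /dgeS[x [_ nx dx]]; apply: (prime_chain_below sN nx).
by apply: IH => //; exact: submodule_addx.
Qed.

End Depth.

(** * Lengths *)

Section Length.
Variable R : comNzRingType.
Implicit Types V W : lmodType R.

Lemma subchain0 V (N0 N1 : V -> Prop) :
  subchain N0 N1 0 <-> N0 = N1 /\ submodule N0.
Proof.
split=> [[C [C0 C1 CS _]]|[<- sN]].
  have <- : C 0%N = N0 by exact: pred_ext.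
  by split; [exact: pred_ext|exact: CS].
by exists (fun=> N0); split.
Qed.

Lemma subchainS V (N0 N1 : V -> Prop) k : subchain N0 N1 k.+1 <->
  exists N', [/\ subchain N0 N' k, submodule N1 & strict_incl N' N1].
Proof.
split=> [[C [C0 C1 CS Cst]]|[N' [[C [C0 C1 CS Cst]] sN1 st]]].
  have <- : C k.+1 = N1 by exact: pred_ext.
  exists (C k); split; [exists C; split=> // i ik|exact: CS|exact: Cst].
    exact/CS/leqW.
  exact/Cst/leqW.
have Ek : C k = N' by exact: pred_ext.
exists (fun i => if (i <= k)%N then C i else N1); split=> // [v|i ik|i].
- by rewrite ltnn.
- by case: leqP => // /CS.
- rewrite ltnS => ik; rewrite ik; case: (ltnP i k) => [ik'|ki]; first exact: Cst.
  by have -> : i = k by [apply/eqP; rewrite eqn_leq ik]; rewrite Ek.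
Qed.

Lemma subchain_submodule V (N0 N1 : V -> Prop) k :
  subchain N0 N1 k -> submodule N0 /\ submodule N1.
Proof.
elim: k N1 => [|k IH] N1; first by move=> /subchain0[<-].
by move=> /subchainS[N' [/IH[sN0 _] sN1 _]].
Qed.

Lemma subchain_incl V (N0 N1 : V -> Prop) k :
  subchain N0 N1 k -> forall v, N0 v -> N1 v.
Proof.
elim: k N1 => [|k IH] N1; first by move=> /subchain0[<-].
by move=> /subchainS[N' [/IH N0N' _ [N'N1 _]]] v /N0N' /N'N1.
Qed.

Lemma subchain_cat V (N0 N1 N2 : V -> Prop) a b :
  subchain N0 N1 a -> subchain N1 N2 b -> subchain N0 N2 (a + b).
Proof.
move=> Ha; elim: b N2 => [|b IH] N2; first by move=> /subchain0[<-]; rewrite addn0.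
by move=> /subchainS[N' [/IH Hb sN2 st]]; rewrite addnS; apply/subchainS; exists N'.
Qed.

Lemma subchain_weak V (N0 N1 : V -> Prop) : submodule N0 -> submodule N1 ->
  (forall v, N0 v -> N1 v) ->
  exists b : bool, subchain N0 N1 b /\ (~~ b -> N0 = N1).
Proof.
move=> s0 s1 N01; case: (EM (forall v, N1 v -> N0 v)) => [N10|].
  have E : N0 = N1 by apply: pred_ext => v; split; [exact: N01|exact: N10].
  by exists false; split=> //; apply/subchain0.
move=> /existsNP[v /not_implyP[N1v nN0]]; exists true; split=> //.
apply/subchainS; exists N0; split=> //; first exact/subchain0.
by split=> //; exists v.
Qed.

(** Replaces Jordan-Hölder in the additivity of length. By the modular law, a strict step stays
    strict after intersecting with [N1] or after adding [N1], so no step is lost in [a + b]. *)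
Lemma subchain_cut V (N0 N1 N : V -> Prop) k : submodule N1 ->
  (forall v, N0 v -> N1 v) -> subchain N0 N k ->
  exists a b, [/\ subchain N0 (fun v => N v /\ N1 v) a,
                  subchain N1 (sumS N1 N) b & (k <= a + b)%N].
Proof.
move=> s1 N01; elim: k N => [|k IH] N.
  move=> /subchain0[<- s0]; exists 0%N, 0%N; split=> //; apply/subchain0; split=> //.
    by apply: pred_ext => v; split=> [Nv|[]//]; split=> //; exact: N01.
  apply: pred_ext => v; split; first exact: sumSl.
  by case=> a [b [Na /N01 Nb ->]]; case: s1 => _ ND _; exact: ND.
move=> /subchainS[N' [Hk sN [N'N [v [Nv nN'v]]]]].
have [a [b [Ha Hb kab]]] := IH _ Hk.
have [s0 sN'] := subchain_submodule Hk.
have [|||x [Hx xE]] := @subchain_weak V (fun v => N' v /\ N1 v) (fun v => N v /\ N1 v).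
- exact: submoduleI.
- exact: submoduleI.
- by move=> u [/N'N].
have [|||y [Hy yE]] := @subchain_weak V (sumS N1 N') (sumS N1 N).
- exact: submodule_sumS.
- exact: submodule_sumS.
- by move=> _ [c [e [Nc /N'N Ne ->]]]; exists c, e.
exists (a + x)%N, (b + y)%N.
split; [exact: subchain_cat Ha Hx|exact: subchain_cat Hb Hy|].
rewrite addnACA -addn1; apply: leq_add => //.
case: x xE {Hx} => // xE; case: y yE {Hy} => // yE; case: nN'v.
have [c [e [N1c N'e Ev]]] : sumS N1 N' v by rewrite yE //; exact: sumSr.
have [N'c _] : N' c /\ N1 c.
  have := congr1 (@^~ c) (xE isT) => /= ->; split=> //.
  by rewrite -(addrK e c) -Ev; apply: submoduleB => //; exact: N'N.
by rewrite Ev; case: sN' => _ ND _; exact: ND.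
Qed.

Lemma subchain_split V (N0 N1 N2 : V -> Prop) k : submodule N1 ->
  (forall v, N0 v -> N1 v) -> (forall v, N1 v -> N2 v) -> subchain N0 N2 k ->
  exists a b, [/\ subchain N0 N1 a, subchain N1 N2 b & (k <= a + b)%N].
Proof.
move=> s1 N01 N12 Hk; have [s0 s2] := subchain_submodule Hk.
have [a [b [Ha Hb kab]]] := subchain_cut s1 N01 Hk; exists a, b; split=> //.
  suff <- : (fun v => N2 v /\ N1 v) = N1 by [].
  by apply: pred_ext => v; split=> [[]//|N1v]; split=> //; exact: N12.
suff <- : sumS N1 N2 = N2 by [].
apply: pred_ext => v; split=> [[c [e [/N12 Nc Ne ->]]]|N2v]; last exact: sumSr.
by case: s2 => _ ND _; exact: ND.
Qed.

Lemma qlength_uniq V (N0 N1 : V -> Prop) a b :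
  qlength N0 N1 a -> qlength N0 N1 b -> a = b.
Proof. by move=> [Ha a_max] [Hb b_max]; apply/eqP; rewrite eqn_leq b_max ?a_max. Qed.

Lemma qlength_add V (N0 N1 N2 : V -> Prop) a b :
  qlength N0 N1 a -> qlength N1 N2 b -> qlength N0 N2 (a + b).
Proof.
move=> [Ha a_max] [Hb b_max]; split; first exact: subchain_cat Ha Hb.
move=> k Hk; have [_ s1] := subchain_submodule Ha.
have [a' [b' [Ha' Hb' kab]]] :=
  subchain_split s1 (subchain_incl Ha) (subchain_incl Hb) Hk.
by apply: leq_trans kab _; apply: leq_add; [exact: a_max|exact: b_max].
Qed.

Lemma qlength_refl V (N : V -> Prop) : submodule N -> qlength N N 0.
Proof.
move=> sN; split=> [|[|k]//]; first exact/subchain0.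
by move=> /subchainS[N' [/subchain_incl NN' _ [_ [v [/NN' ? []]]]]].
Qed.

Lemma qlength_bounded V (N0 N1 : V -> Prop) c :
  (exists k, subchain N0 N1 k) -> (forall k, subchain N0 N1 k -> (k <= c)%N) ->
  exists l, qlength N0 N1 l.
Proof.
move=> [k Hk] Hc.
have ex : exists k, `[<subchain N0 N1 k>] by exists k; apply/asboolP.
have bd k' : `[<subchain N0 N1 k'>] -> (k' <= c)%N by move=> /asboolP /Hc.
case: (ex_maxnP ex bd) => l /asboolP Hl lmax; exists l; split=> // j Hj.
by apply: lmax; apply/asboolP.
Qed.

Lemma qlength_sub V (N0 N1 N2 : V -> Prop) a c : submodule N1 ->
  (forall v, N1 v -> N2 v) ->
  qlength N0 N1 a -> qlength N0 N2 c -> exists2 b, qlength N1 N2 b & c = (a + b)%N.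
Proof.
move=> s1 N12 Ha Hc; have [Ha1 _] := Ha; have [Hc1 cmax] := Hc.
have [_ s2] := subchain_submodule Hc1.
have [|k Hk|b Hb] := @qlength_bounded V N1 N2 c.
- by have [x [Hx _]] := subchain_weak s1 s2 N12; exists x.
- apply: leq_trans (leq_addl a k) _; apply: cmax; exact: subchain_cat Hk.
by exists b => //; exact: qlength_uniq Hc (qlength_add Ha Hb).
Qed.

Section Transport.
Variables (V W : lmodType R) (f : V -> W) (N0 N1 : V -> Prop) (N0' N1' : W -> Prop).
Hypotheses (linf : linear f) (s1 : submodule N1) (s0' : submodule N0') (s1' : submodule N1').
Hypotheses (f1 : forall v, N1 v -> N1' (f v)) (N01' : forall w, N0' w -> N1' w).
Hypothesis N01 : forall v, N0 v -> N1 v.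
Hypothesis f_onto : forall w, N1' w -> exists2 v, N1 v & N0' (w - f v).
Hypothesis f_ker : forall v, N1 v -> (N0' (f v) <-> N0 v).

Let fD u v : f (u + v) = f u + f v.
Proof. by rewrite -{1}[u]scale1r linf scale1r. Qed.
Let f0 : f 0 = 0.
Proof. by apply: (addrI (f 0)); rewrite -fD !addr0. Qed.
Let fZ r v : f (r *: v) = r *: f v.
Proof. by rewrite -{1}[r *: v]addr0 linf f0 addr0. Qed.
Let fB u v : f (u - v) = f u - f v.
Proof. by rewrite fD -scaleN1r fZ scaleN1r. Qed.

Let img (N : V -> Prop) : W -> Prop := fun w => exists2 v, N v & N0' (w - f v).
Let pre (N : W -> Prop) : V -> Prop := fun v => N1 v /\ N (f v).

Let submodule_img N : submodule N -> submodule (img N).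
Proof.
move=> [K0 KD KZ]; have [N00 ND NZ] := s0'.
split=> [|w w' [v Kv Hv] [v' Kv' Hv']|r w [v Kv Hv]].
- by exists 0; rewrite // f0 subr0.
- by exists (v + v'); [exact: KD|rewrite fD opprD addrACA; exact: ND].
- by exists (r *: v); [exact: KZ|rewrite fZ -scalerBr; exact: NZ].
Qed.

Let submodule_pre N : submodule N -> submodule (pre N).
Proof.
move=> [K0 KD KZ]; have [N00 ND NZ] := s1.
split=> [|v v' [Nv Kv] [Nv' Kv']|r v [Nv Kv]]; rewrite /pre ?f0 ?fD ?fZ //.
  by split; [exact: ND|exact: KD].
by split; [exact: NZ|exact: KZ].
Qed.

Let chain_img N k : subchain N0 N k -> (forall v, N v -> N1 v) ->
  subchain N0' (img N) k.
Proof.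
elim: k N => [|k IH] N.
  move=> /subchain0[<- s0] _; apply/subchain0; split=> //.
  apply: pred_ext => w; split=> [Nw|[v N0v Nw]].
    by exists 0; [case: s0|rewrite f0 subr0].
  rewrite -(subrK (f v) w); case: s0' => _ ND _; apply: ND => //.
  by apply/f_ker => //; exact: N01.
move=> /subchainS[N' [Hk sN [N'N [v [Nv nN'v]]]]] NN1.
have [_ sN'] := subchain_submodule Hk.
apply/subchainS; exists (img N'); split.
- by apply: IH => // u /N'N /NN1.
- exact: submodule_img.
- split=> [w [u N'u Hu]|]; first by exists u => //; exact: N'N.
  exists (f v); split=> [|[u N'u]]; first by exists v; rewrite // subrr; case: s0'.
  rewrite -fB => Hvu; apply: nN'v; rewrite -(subrK u v).
  case: sN' => _ ND _; apply: ND => //; apply: (subchain_incl Hk); apply/f_ker => //.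
  by apply: submoduleB => //; apply: NN1 => //; exact: N'N.
Qed.

Let chain_pre N k : subchain N0' N k -> (forall w, N w -> N1' w) ->
  subchain N0 (pre N) k.
Proof.
elim: k N => [|k IH] N.
  move=> /subchain0[<- _] _.
  have E : N0 = pre N0'.
    apply: pred_ext => v; split=> [N0v|[N1v /f_ker]]; last exact.
    suff N1v : N1 v by split=> //; apply/f_ker.
    exact: N01.
  by apply/subchain0; split=> //; rewrite E; exact: submodule_pre.
move=> /subchainS[N' [Hk sN [N'N [w [Nw nN'w]]]]] NN1.
have [_ sN'] := subchain_submodule Hk.
apply/subchainS; exists (pre N'); split.
- by apply: IH => // u /N'N /NN1.
- exact: submodule_pre.
- split=> [v [N1v N'v]|]; first by split=> //; exact: N'N.
  have [v N1v Hv] := f_onto (NN1 _ Nw).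
  have N'v := subchain_incl Hk Hv.
  exists v; split=> [|[_ N'fv]].
    by split=> //; rewrite -[f v](subKr w); apply: submoduleB => //; exact: N'N.
  by apply: nN'w; rewrite -(subrK (f v) w); case: sN' => _ ND _; exact: ND.
Qed.

(** [f_onto] and [f_ker] say that [f] induces an isomorphism from [N1/N0] to [N1'/N0']; strict
    chains are pushed forward by [img] and pulled back by [pre]. *)
Lemma qlength_transport l : qlength N0 N1 l -> qlength N0' N1' l.
Proof.
move=> [Hl lmax]; split=> [|k Hk].
  suff <- : img N1 = N1' by exact: chain_img.
  apply: pred_ext => w; split=> [[v N1v Hw]|]; last exact: f_onto.
  by rewrite -(subrK (f v) w); case: s1' => _ ND _; apply: ND; [exact: N01'|exact: f1].
apply: lmax; suff <- : pre N1' = N1 by exact: chain_pre.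
by apply: pred_ext => v; split=> [[]//|N1v]; split=> //; exact: f1.
Qed.

End Transport.
End Length.

(** * Free resolutions *)

Section SubmoduleType.
Variables (R : comNzRingType) (V : lmodType R) (N : V -> Prop) (sN : submodule N).

Definition in_submodule of submodule N : {pred V} := fun v => `[<N v>].

Fact in_submodule_closed : submod_closed (in_submodule sN).
Proof.
have [N0 ND NZ] := sN; split=> [|r u v /asboolP Nu /asboolP Nv]; apply/asboolP => //.
by apply: ND => //; exact: NZ.
Qed.

HB.instance Definition _ :=
  GRing.isSubmodClosed.Build R V (in_submodule sN) in_submodule_closed.

(** [projective] lifts only along maps onto a whole module, so the image of a map has to become an
    [lmodType] before one can lift along it. *)
Definition submodule_type := {v : V | v \in in_submodule sN}.
HB.instance Definition _ := SubChoice.on submodule_type.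
HB.instance Definition _ := [SubChoice_isSubLmodule of submodule_type by <:].

End SubmoduleType.

Section Lifting.
Variable R : comNzRingType.

Lemma projective_lift (P F G : lmodType R) (D : {linear F -> G}) (u : {linear P -> G}) :
  projective P -> (forall p, exists x, D x = u p) ->
  exists w : {linear P -> F}, forall p, D (w p) = u p.
Proof.
move=> prP uD.
pose N y := exists x, D x = y.
have sN : submodule N.
  split=> [|_ _ [x <-] [y <-]|r _ [x <-]]; first by exists 0; rewrite linear0.
    by exists (x + y); rewrite linearD.
  by exists (r *: x); rewrite linearZ.
have ND x : D x \in in_submodule sN by apply/asboolP; exists x.
have Nu p : u p \in in_submodule sN by apply/asboolP; exact: uD.
pose D1 x : submodule_type sN := Sub (D x) (ND x).
pose u1 p : submodule_type sN := Sub (u p) (Nu p).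
have lD : linear D1 by move=> a x y; apply: val_inj; rewrite !SubK linearP.
have lu : linear u1 by move=> a x y; apply: val_inj; rewrite !SubK linearP.
pose D2 : {linear F -> submodule_type sN} :=
  HB.pack D1 (GRing.isLinear.Build R F (submodule_type sN) _ D1 lD).
pose u2 : {linear P -> submodule_type sN} :=
  HB.pack u1 (GRing.isLinear.Build R P (submodule_type sN) _ u1 lu).
have [|w Hw] := prP _ _ D2 u2.
  move=> y; have /asboolP[x Ex] := valP y; exists x; apply: val_inj.
  by rewrite -Ex SubK.
by exists w => p; have := congr1 val (Hw p); rewrite !SubK.
Qed.

End Lifting.

(** * Minimal free resolutions and their comparison with projective ones *)

Section Resolution.
Variables (R : comNzRingType) (m : R -> Prop).
Hypothesis Hloc : local_ring m.
Implicit Types V W : lmodType R.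
Let noeR := local_noetherian Hloc.
Let im := local_ideal Hloc.

(** The number of generators is taken least possible: a relation with a unit coefficient would
    express one generator by the others. *)
Lemma minimal_generators V (l : seq V) (K : V -> Prop) :
  submodule K -> (forall v, K v -> sp l v) ->
  exists k (s : 'I_k -> V), (forall v, K v <-> exists c, v = lincomb s c) /\
    (forall c, lincomb s c = 0 -> forall i, m (c 0 i)).
Proof.
move=> sK Kl; have [g Eg] := fg_submodule noeR sK Kl.
pose Q k := exists s : 'I_k -> V, forall v, K v <-> exists c, v = lincomb s c.
have ex : exists k, `[<Q k>].
  exists (size g); apply/asboolP; exists (tnth (in_tuple g)) => v.
  rewrite -span_lincomb Eg; split; apply: span_min; try exact: submodule_span.
    by move=> w /(@tnthP _ _ (in_tuple g))[i ->]; apply: span_incl; exists i.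
  by move=> _ [i ->]; apply: span_incl; exact: mem_tnth.
case: (ex_minnP ex) => k /asboolP[s Hs] kmin; exists k, s; split=> // c c0 i.
apply: contrapT => /(local_unit Hloc)[y cy].
case: k s Hs kmin c c0 i cy => [|k] s Hs kmin c c0 i cy; first by case: i cy.
suff: (k.+1 <= k)%N by rewrite ltnn.
apply: kmin; apply/asboolP; exists (fun j => s (lift i j)) => v.
pose S := span (fun w => exists j, w = s (lift i j)).
have sS : submodule S by exact: submodule_span.
have [_ _ SZ] := sS.
have Sl j : S (s (lift i j)) by apply: span_incl; exists j.
have Si : S (s i).
  have Ei : s i = - (y *: \sum_(j | j != i) c 0 j *: s j).
    move: c0; rewrite /lincomb (bigD1 i) //= addrC => /eqP; rewrite addr_eq0 => /eqP ->.
    by rewrite scalerN opprK scalerA mulrC cy scale1r.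
  rewrite Ei; apply: submoduleN => //; apply: (SZ); apply: submodule_sum => // j ji.
  by apply: (SZ); case: (unliftP i j) ji => [j' ->|->]; rewrite ?eqxx.
rewrite -span_lincomb; split=> [/Hs[d ->]|].
  apply: submodule_sum => // j _; apply: (SZ).
  by case: (unliftP i j) => [j' ->|->].
apply: span_min => // _ [j ->]; apply/Hs; exists (delta_mx 0 (lift i j)).
by rewrite lincomb_delta.
Qed.

Lemma lincomb_row n k (D : 'M[R]_(n, k)) v : lincomb (fun i => row i D) v = v *m D.
Proof. by rewrite mulmx_sum_row. Qed.

Lemma rV_fg n : exists l : seq 'rV[R]_n, forall v, sp l v.
Proof.
apply: fin_gen_fg; exists n, (fun i => delta_mx 0 i) => v; apply/span_lincomb.
by exists v; rewrite /lincomb -row_sum_delta.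
Qed.

Lemma minimal_syzygy a b (D : 'M[R]_(a, b)) : exists k (E : 'M[R]_(k, a)),
  (forall v : 'rV_a, v *m D = 0 <-> exists w, v = w *m E) /\
  (forall w : 'rV_k, w *m E = 0 -> forall i, m (w 0 i)).
Proof.
have [l Hl] := rV_fg a.
have sK : submodule (fun v : 'rV_a => v *m D = 0).
  split=> [|u v u0 v0|r v v0]; first exact: mul0mx.
    by rewrite mulmxDl u0 v0 addr0.
  by rewrite -scalemxAl v0 scaler0.
have [k [s [Hs Hm]]] := @minimal_generators _ l _ sK (fun v _ => Hl v).
have Es c : lincomb s c = c *m \matrix_i s i.
  by rewrite -lincomb_row /lincomb; apply: eq_bigr => i _; rewrite rowK.
exists k, (\matrix_i s i); split=> [v|w w0 i]; last by apply: Hm; rewrite Es.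
by rewrite Hs; split=> -[c ->]; exists c; rewrite Es.
Qed.

Lemma minimal_resolution V : fin_gen V ->
  exists (r : nat -> nat) (s : 'I_(r 0%N) -> V) (D : forall i, 'M[R]_(r i.+1, r i)),
  [/\ forall y, exists v, y = lincomb s v,
      forall v, lincomb s v = 0 <-> exists w, v = w *m D 0%N,
      forall i (v : 'rV_(r i.+1)), v *m D i = 0 <-> exists w, v = w *m D i.+1 &
      forall i a b, m (D i a b)].
Proof.
move=> /fin_gen_fg[l Hl].
have [n0 [s [Hs Hm]]] := @minimal_generators V l (fun _ => True) (submoduleT V) (fun v _ => Hl v).
have sK : submodule (fun v => lincomb s v = 0).
  split=> [|u v u0 v0|a v v0]; rewrite ?linear0 ?linearD ?linearZ /= ?u0 ?v0 ?addr0 //.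
  exact: scaler0.
have [l0 Hl0] := rV_fg n0.
have [n1 [s1 [Hs1 Hm1]]] := minimal_generators sK (fun v _ => Hl0 v).
have Es1 c : lincomb s1 c = c *m \matrix_i s1 i.
  by rewrite -lincomb_row /lincomb; apply: eq_bigr => i _; rewrite rowK.
pose T := {a : nat & {b : nat & 'M[R]_(a, b)}}.
have Hex : forall st : T, exists kE : {k : nat & 'M[R]_(k, projT1 st)},
    (forall v : 'rV_(projT1 st), v *m projT2 (projT2 st) = 0 <-> exists w, v = w *m projT2 kE) /\
    (forall w : 'rV_(projT1 kE), w *m projT2 kE = 0 -> forall i, m (w 0 i)).
  by case=> a [b D]; have [k [E HE]] := minimal_syzygy D; exists (existT _ k E).
pose nx st := projT1 (cid (Hex st)).
have Hnx st :
    (forall v : 'rV_(projT1 st), v *m projT2 (projT2 st) = 0 <-> exists w, v = w *m projT2 (nx st)) /\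
    (forall w : 'rV_(projT1 (nx st)), w *m projT2 (nx st) = 0 -> forall i, m (w 0 i)).
  exact: projT2 (cid (Hex st)).
pose nxt (st : T) : T := existT _ (projT1 (nx st)) (existT _ (projT1 st) (projT2 (nx st))).
pose st0 : T := existT _ n1 (existT _ n0 (\matrix_i s1 i)).
pose st i := iter i nxt st0.
pose r i := projT1 (projT2 (st i)).
pose D i : 'M[R]_(r i.+1, r i) := projT2 (projT2 (st i)).
have minD i : forall w : 'rV_(r i.+1), w *m D i = 0 -> forall j, m (w 0 j).
  case: i => [|i] w w0; last exact: (Hnx (st i)).2.
  by apply: Hm1; rewrite Es1.
exists r, s, D; split=> //.
- by move=> y; apply/Hs.
- by move=> v; rewrite Hs1; split=> -[w ->]; exists w; rewrite ?Es1 // -Es1.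
- by move=> i v; exact: (Hnx (st i)).1.
- case=> [|i] a b.
    suff: m (row a (D 0%N) 0 b) by rewrite mxE.
    apply: Hm; apply/Hs1.
    by exists (delta_mx 0 a); rewrite Es1 -rowE.
  suff: m (row a (D i.+1) 0 b) by rewrite mxE.
  apply: minD.
  by apply/((Hnx (st i)).1 _); exists (delta_mx 0 a); rewrite -rowE.
Qed.

Lemma ideal_mulmx n k l (A : 'M[R]_(n, k)) (B : 'M[R]_(k, l)) (I : R -> Prop) :
  is_ideal I -> (forall i j, I (A i j)) -> forall i j, I ((A *m B) i j).
Proof. by move=> iI IA i j; rewrite mxE; apply: ideal_sum => // h _; exact: idealMr. Qed.

Lemma ideal_mulmxr n k l (A : 'M[R]_(n, k)) (B : 'M[R]_(k, l)) (I : R -> Prop) :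
  is_ideal I -> (forall i j, I (B i j)) -> forall i j, I ((A *m B) i j).
Proof. by move=> iI IB i j; rewrite mxE; apply: ideal_sum => // h _; exact: idealMl. Qed.

Section Compare.
Variables (M : lmodType R) (r : nat -> nat) (s : 'I_(r 0%N) -> M).
Variable D : forall i, 'M[R]_(r i.+1, r i).
Hypotheses (s_onto : forall y, exists v, y = lincomb s v)
  (ex0 : forall v, lincomb s v = 0 <-> exists w, v = w *m D 0%N)
  (exD : forall i (v : 'rV_(r i.+1)), v *m D i = 0 <-> exists w, v = w *m D i.+1)
  (mD : forall i a b, m (D i a b)).
Variables (P : nat -> lmodType R) (dd : forall i, {linear P i.+1 -> P i})
  (eps : {linear P 0%N -> M}).
Hypotheses (prP : forall i, projective (P i))
  (eps_onto : forall y, exists x, eps x = y)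
  (exP0 : forall x, eps x = 0 <-> exists y, dd 0%N y = x)
  (exP : forall i (x : P i.+1), dd i x = 0 <-> exists y, dd i.+1 y = x).

Let DD i : D i.+1 *m D i = 0.
Proof.
apply: row_mul_eq => v; rewrite mulmx0 mulmxA; apply/exD; by exists v.
Qed.

(* [h f] is homotopic to the identity through [E = D S], whose entries lie in [m]. *)
Lemma comparison i : exists (f : {linear 'rV[R]_(r i) -> P i})
    (h : {linear P i -> 'rV[R]_(r i)}) (E : 'M[R]_(r i)),
  [/\ forall w : 'rV_(r i.+1), exists p, dd i p = f (w *m D i),
      forall p, exists w, h (dd i p) = w *m D i,
      forall v, exists w, h (f v) - v - v *m E = w *m D i,
      D i *m E = 0 & forall a b, m (E a b)].
Proof.
elim: i => [|i [f [h [E [H1 H2 H3 H4 H5]]]]].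
  have /choice[p Hp] : forall j, exists p, eps p = s j by move=> j; exact: eps_onto.
  have [|h Hh] := @prP 0%N _ _ (lincomb s) eps.
    by move=> y; have [v ->] := s_onto y; exists v.
  have Hf v : eps (lincomb p v) = lincomb s v.
    by rewrite /lincomb linear_sum; apply: eq_bigr => j _; rewrite linearZ /= Hp.
  exists (lincomb p), h, 0; split.
  - move=> w; apply/exP0; rewrite Hf; apply/ex0; by exists w.
  - by move=> q; apply/ex0; rewrite Hh; apply/exP0; exists q.
  - by move=> v; apply/ex0; rewrite mulmx0 subr0 linearB /= Hh Hf subrr.
  - exact: mulmx0.
  - by move=> a b; rewrite mxE; case: im.
have /choice[p Hp] : forall j, exists p, dd i p = f (delta_mx 0 j *m D i).
  by move=> j; exact: H1.
have Hf v : dd i (lincomb p v) = f (v *m D i).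
  rewrite /lincomb linear_sum [in RHS](row_sum_delta v) mulmx_suml linear_sum.
  by apply: eq_bigr => j _; rewrite linearZ /= Hp -scalemxAl linearZ.
have [|h' Hh'] := @projective_lift R (P i.+1) _ _ (mulmxr (D i)) (h \o dd i) (@prP i.+1).
  by move=> q; have [w Ew] := H2 q; exists w; rewrite /= Ew.
have /choice[S HS] : forall j, exists w, h (f (delta_mx 0 j)) - delta_mx 0 j - delta_mx 0 j *m E = w *m D i.
  by move=> j; exact: H3.
pose Sm := \matrix_j S j.
have HL v : h (f v) = v *m lin1_mx (h \o f) by rewrite mul_rV_lin1.
have SD : Sm *m D i = lin1_mx (h \o f) - 1%:M - E.
  apply/row_matrixP => j; rewrite row_mul rowK -HS HL rowE.
  by rewrite !mulmxBr mulmx1.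
have HSm v : v *m Sm *m D i = h (f v) - v - v *m E.
  by rewrite -mulmxA SD HL !mulmxBr mulmx1.
exists (lincomb p), h', (D i *m Sm); split.
- move=> w; apply/exP; rewrite Hf -mulmxA DD mulmx0; exact: linear0.
- move=> q; apply/exD; have /= -> := Hh' (dd i.+1 q).
  by have -> : dd i (dd i.+1 q) = 0 by [apply/exP; exists q]; rewrite linear0.
- move=> v; apply/exD; rewrite !mulmxBl; have /= -> := Hh' (lincomb p v).
  (* All that survives of the previous homotopy is [v D_i E]; the relation [D_i E = 0], carried
     through the induction, removes it. *)
  rewrite Hf mulmxA HSm -[v *m D i *m E]mulmxA H4 mulmx0 subr0.
  by rewrite subrr.
- by rewrite mulmxA DD mul0mx.
- by apply: ideal_mulmx => // a b; exact: mD.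
Qed.

(** When [P i] is zero, [h f] is zero, so a basis vector equals minus the sum of a homotopy term and
    a boundary. Both have entries in [m], while the basis vector has an entry 1. *)
Lemma rank_vanish i : (forall x : P i, x = 0) -> r i = 0%N.
Proof.
move=> P0; have [f [h [E [_ _ H3 _ H5]]]] := comparison i.
case Er: (r i) => [//|k]; have j : 'I_(r i) by rewrite Er; exact: ord0.
have [w Hw] := H3 (delta_mx 0 j); case: (local_proper Hloc).
have := congr1 (fun A : 'rV_(r i) => A 0 j) Hw.
rewrite (P0 (f _)) linear0 sub0r => Hj.
have -> : 1 = - ((w *m D i) 0 j + (delta_mx 0 j *m E : 'rV_(r i)) 0 j) :> R.
  by rewrite -Hj !mxE !eqxx subrK opprK.
rewrite -mulN1r; apply: idealMl => //; apply: idealD => //.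
  by apply: ideal_mulmxr => // a b; exact: mD.
exact: ideal_mulmxr.
Qed.

End Compare.
End Resolution.

(** * The case of the Auslander-Buchsbaum formula with depth gap one *)

Section AuslanderBuchsbaum.
Variables (R : comNzRingType) (m : R -> Prop).
Hypothesis Hloc : local_ring m.
Implicit Types V W : lmodType R.

Lemma fin_gen_regular : fin_gen R^o.
Proof.
exists 1%N, (fun=> 1) => v; apply/span_lincomb; exists (const_mx v).
by rewrite /lincomb big_ord1 mxE -[RHS]/(v * 1) mulr1.
Qed.

(* Exactness at the middle of [V1 -> V2/N2 -> V3/N3]. *)
Definition exmod V1 V2 V3 (a : V1 -> V2) (b : V2 -> V3)
    (N2 : V2 -> Prop) (N3 : V3 -> Prop) : Prop :=
  forall u, N3 (b u) -> exists u1, N2 (u - a u1).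

(** If [b u = n + x w], applying [c] and cancelling [x] on [V4/N4] makes [w] a cycle, hence some
    [b u'] modulo [N3]; then [u - x u'] is a cycle modulo [N3]. Only regularity two places to the
    right is used. *)
Lemma exmod_addx V1 V2 V3 V4 (a : V1 -> V2) (b : {linear V2 -> V3})
    (c : {linear V3 -> V4}) (N2 : V2 -> Prop) (N3 : V3 -> Prop) (N4 : V4 -> Prop) x :
  submodule N3 -> submodule N4 -> (forall u, c (b u) = 0) ->
  (forall w, N3 w -> N4 (c w)) -> exmod a b N2 N3 -> exmod b c N3 N4 ->
  nzdmod N4 x -> exmod a b (addx N2 x) (addx N3 x).
Proof.
move=> s3 s4 cb N34 exab exbc nx u [n [w [Nn Eu]]].
have [|u' Hu'] := exbc w.
  apply: nx; rewrite -linearZ /=.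
  have -> : x *: w = b u - n by rewrite Eu addrC addKr.
  by rewrite linearB /= cb sub0r; apply: submoduleN => //; exact: N34.
have [|u1 Hu1] := exab (u - x *: u').
  have -> : b (u - x *: u') = n + x *: (w - b u').
    by rewrite linearB linearZ /= Eu scalerBr addrA.
  by case: s3 => _ ND NZ; apply: ND => //; exact: NZ.
exists u1, (u - x *: u' - a u1), u'; split=> //.
by rewrite addrAC subrK.
Qed.

Definition vecS (J : R -> Prop) {n} (v : 'rV[R]_n) : Prop := forall i, J (v 0 i).

Lemma submodule_vecS J n : is_ideal J -> submodule (@vecS J n).
Proof.
move=> iJ; split=> [i|u v Ju Jv i|r v Jv i]; rewrite mxE; first by case: iJ.
  exact: idealD.
exact: idealMl.
Qed.

Lemma addx_vecS (J : R -> Prop) n x :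
  addx (@vecS J n) x = @vecS (@addx R R^o J x) n.
Proof.
apply: pred_ext => v; split=> [[u [w [Ju ->]]] i|Hv].
  by exists (u 0 i), (w 0 i); rewrite !mxE.
have /choice[f Hf] : forall i, exists p : R * R, J p.1 /\ v 0 i = p.1 + x * p.2.
  by move=> i; have [a [b [Ja Ev]]] := Hv i; exists (a, b).
exists (\row_i (f i).1), (\row_i (f i).2); split=> [i|].
  by rewrite mxE; case: (Hf i).
by apply/rowP => i; rewrite !mxE; case: (Hf i).
Qed.

Lemma nzdmod_vecS (J : R -> Prop) n x :
  @nzdmod R R^o J x -> nzdmod (@vecS J n) x.
Proof. by move=> nx v Jv i; apply: nx; have := Jv i; rewrite mxE. Qed.

Lemma vecS_mul (J : R -> Prop) n k (v : 'rV[R]_n) (D : 'M[R]_(n, k)) :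
  is_ideal J -> vecS J v -> vecS J (v *m D).
Proof.
by move=> iJ Jv i; apply: ideal_mulmx => // a b; rewrite ord1.
Qed.

Section Vanishing.
Variables (M : lmodType R) (r : nat -> nat) (s : 'I_(r 0%N) -> M).
Variable D : forall i, 'M[R]_(r i.+1, r i).
Hypotheses (fM : fin_gen M) (s_onto : forall y, exists v, y = lincomb s v)
  (ex0 : forall v, lincomb s v = 0 <-> exists w, v = w *m D 0%N)
  (exD : forall i (v : 'rV_(r i.+1)), v *m D i = 0 <-> exists w, v = w *m D i.+1)
  (mD : forall i a b, m (D i a b)).

Let D0s u : lincomb s (u *m D 0%N) = 0.
Proof. by apply/ex0; exists u. Qed.

Let DD i (v : 'rV_(r i.+2)) : v *m D i.+1 *m D i = 0.
Proof. by apply/exD; exists v. Qed.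

(** The free modules are reduced modulo [J] and [M] modulo [N]; the condition on [a *: y] makes the
    augmentation well defined on the quotients. *)
Definition exact_mod (J : R^o -> Prop) (N : M -> Prop) : Prop :=
  [/\ is_ideal J, submodule N, forall a y, J a -> N (a *: y),
      exmod (mulmxr (D 0%N)) (lincomb s) (vecS J) N &
      forall i, exmod (mulmxr (D i.+1)) (mulmxr (D i)) (vecS J) (vecS J)].

Lemma exact_mod0 : exact_mod (fun x => x = 0) (fun y => y = 0).
Proof.
split.
- exact: submodule_eq0.
- exact: submodule_eq0.
- by move=> a y ->; rewrite scale0r.
- by move=> u /ex0[w ->]; exists w => i; rewrite /= subrr mxE.
- move=> i u Hu; have /exD[w ->] : u *m D i = 0.
    by apply/rowP => j; rewrite [RHS]mxE; exact: Hu.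
  by exists w => j; rewrite /= subrr mxE.
Qed.

Lemma exact_mod_addx J N x : exact_mod J N -> @nzdmod R R^o J x -> nzdmod N x ->
  exact_mod (addx J x) (addx N x).
Proof.
move=> [iJ sN JN e0 eD] nJ nN; have iJx : is_ideal (addx J x) by exact: submodule_addx.
have sJ n : submodule (@vecS J n) by exact: submodule_vecS.
have Ns v : vecS J v -> N (lincomb s v).
  by move=> Jv; apply: submodule_sum => // i _; exact: JN.
split=> //; first exact: submodule_addx.
- move=> _ y [b [c [Jb ->]]]; exists (b *: y), (c *: y); split; first exact: JN.
  by rewrite scalerDl scalerA.
- rewrite -addx_vecS.
  (* Nothing follows [M], so the complex is continued by the zero map; exactness at [M] is then
     surjectivity of [lincomb s]. *)
  apply: (@exmod_addx _ _ _ M (mulmxr (D 0%N)) (lincomb s) \0 _ _ (fun=> True)) => //.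
  move=> y _; have [v ->] := s_onto y; exists v; rewrite subrr; by case: sN.
- case=> [|i]; rewrite -!addx_vecS.
    exact: (@exmod_addx _ _ _ _ (mulmxr (D 1%N)) (mulmxr (D 0%N)) (lincomb s) _ _ N).
  apply: (@exmod_addx _ _ _ _ (mulmxr (D i.+2)) (mulmxr (D i.+1)) (mulmxr (D i)) _ _ (vecS J)) => //=.
    by move=> w Jw; exact: vecS_mul.
  exact: nzdmod_vecS.
Qed.

(* Modulo a maximal regular sequence of [A] the resolution is still exact in degrees
   [>= 2], but a matrix over [m] kills the socle of [A/(J + x)]. *)
Lemma rank_vanish_step t J N i : exact_mod J N ->
  dge m J t.+1 -> ~ dge m J t.+2 -> dge m N t -> r i.+3 = 0%N -> r i.+2 = 0%N.
Proof.
move=> + + + + r3; elim: t J N => [|t IH] J N eJN dJ ndJ dN; last first.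
  have [iJ sN _ _ _] := eJN.
  have [z [mz nzJ nzN]] := common_nzd Hloc fin_gen_regular fM iJ sN
    (has_nzd_nosocle (dge_has_nzd dJ)) (has_nzd_nosocle (dge_has_nzd dN)).
  apply: (IH _ _ (exact_mod_addx eJN nzJ nzN)).
  - exact: (dge_exchange Hloc fin_gen_regular).
  - by move=> dz; apply: ndJ; apply/dgeS; exists z.
  - exact: (dge_exchange Hloc fM).
have [iJ _ _ _ eD] := eJN; have /dgeS[x [mx nx /dge0 px]] := dJ.
have iJx : is_ideal (addx J x) by exact: submodule_addx.
(* [A/J] has depth exactly one here. Without such a socle element, an element of [m] regular modulo
   [J + x] would produce depth two. *)
have [u [Hu nu]] : exists u : R^o, (forall a, m a -> addx J x (a *: u)) /\ ~ addx J x u.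
  apply: contrapT => nex; apply: ndJ; apply/dgeS; exists x; split=> //.
  have [|z mz nz] := nosocle_has_nzd Hloc fin_gen_regular iJx.
    by move=> u Hu; apply: contrapT => nu; apply: nex; exists u.
  apply/dgeS; exists z; split=> //; apply/dge0.
  exact: (addx_proper Hloc fin_gen_regular).
case Er: (r i.+2) => [//|k]; have j : 'I_(r i.+2) by rewrite Er; exact: ord0.
(* [x] is known to be regular on [A/J] only, not on [M/N]. Exactness survives because all terms
   involved are free; this is why the descent stops at degree 2. *)
have ex : exmod (mulmxr (D i.+2)) (mulmxr (D i.+1)) (vecS (addx J x)) (vecS (addx J x)).
  rewrite -!addx_vecS.
  apply: (@exmod_addx _ _ _ _ (mulmxr (D i.+2)) (mulmxr (D i.+1)) (mulmxr (D i)) _ _ (vecS J)) => //=.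
  - exact: submodule_vecS.
  - exact: submodule_vecS.
  - by move=> w Jw; exact: vecS_mul.
  - exact: nzdmod_vecS.
have [|w Hw] := ex (u *: delta_mx 0 j).
  move=> h /=; rewrite -scalemxAl -rowE !mxE mulrC; exact/Hu/mD.
case: nu; have := Hw j; rewrite /= !mxE !eqxx mulr1 big1 ?subr0 // => h _.
by exfalso; case: h => h; rewrite r3.
Qed.

End Vanishing.

(** Vanishing of [r 2] makes [D 0] injective. Since [g] kills [M], each [g e_j] lies in the image of
    [D 0], giving [psi D0 = g]; cancelling [D 0] gives the other product, and determinants force the
    two ranks to agree. *)
Lemma square_presentation (M : lmodType R) d g : fin_gen M -> finite_projdim M ->
  depth m R^o d.+1 -> depth m M d -> (forall y : M, g *: y = 0) ->
  (forall c, g * c = 0 -> c = 0) ->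
  exists n (s : 'I_n -> M) (phi psi : 'M[R]_n),
  [/\ forall y, exists v, y = lincomb s v,
      forall v, lincomb s v = 0 <-> exists w, v = w *m phi,
      forall a b, m (phi a b), phi *m psi = g%:M & psi *m phi = g%:M].
Proof.
move=> fM [n [P [dd [eps [prP P0 eps_onto exP0 exP]]]]] dR dM gM g_nzd.
have [r [s [D [s_onto ex0 exD mD]]]] := minimal_resolution Hloc fM.
have r_big i : (n < i)%N -> r i = 0%N.
  by move=> /P0; exact: (rank_vanish Hloc s_onto ex0 exD mD prP eps_onto exP0 exP).
have r_step i : r i.+3 = 0%N -> r i.+2 = 0%N.
  apply: (rank_vanish_step (t := d) fM s_onto ex0 exD mD (exact_mod0 ex0 exD)).
  - exact: depth_dge.
  - by move=> /(depth_dge_max dR); rewrite ltnn.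
  - exact: depth_dge.
have r2 : r 2 = 0%N.
  suff H k i : (n <= i + k)%N -> r i.+2 = 0%N by apply: (H n).
  elim: k i => [|k IH] i; first by rewrite addn0 => ni; apply: r_big; exact: leqW.
  by rewrite -addSnnS => /IH /r_step.
have D0_inj (v : 'rV_(r 1%N)) : v *m D 0%N = 0 -> v = 0.
  move=> /exD[w ->]; apply/rowP => j; rewrite !mxE big1 // => h _.
  by exfalso; case: h => h; rewrite r2.
have /choice[p Hp] : forall j : 'I_(r 0%N), exists w : 'rV_(r 1%N),
    g *: delta_mx 0 j = w *m D 0%N.
  by move=> j; apply/ex0; rewrite linearZ /= gM.
pose psi := \matrix_j p j.
have psiD : psi *m D 0%N = g%:M.
  apply/row_matrixP => j; rewrite row_mul rowK -Hp rowE mul_mx_scalar //.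
have Dpsi : D 0%N *m psi = g%:M.
  apply: row_mul_eq => v; apply/eqP; rewrite -subr_eq0; apply/eqP/D0_inj.
  by rewrite mulmxBl -!mulmxA psiD -scalar_mxC subrr.
have det_g k : g ^+ k != 0.
  elim: k => [|k IH]; first by rewrite expr0 oner_neq0.
  by apply: contra IH => /eqP; rewrite exprS => /g_nzd ->.
have le_rank a b (A : 'M[R]_(a, b)) (B : 'M[R]_(b, a)) : A *m B = g%:M -> (a <= b)%N.
  move=> AB; rewrite leqNgt; apply/negP => ba.
  have := det_g a; rewrite -det_scalar -AB.
  move: A B {AB}; rewrite -(subnKC ba) addSnnS; move: (a - _)%N => k A B.
  (* Padded to squares with zeros, the factors would have a product of determinant zero, against
     [g ^+ a != 0]. *)
  have -> : A *m B = row_mx A (0 : 'M_(_, k.+1)) *m col_mx B 0.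
    by rewrite mul_row_col mul0mx addr0.
  rewrite det_mulmx -det_tr tr_row_mx.
  rewrite (expand_det_row _ (rshift b ord0)) big1 ?mul0r ?eqxx // => j _.
  by rewrite col_mxEd !mxE mul0r.
have Er : r 1%N = r 0%N.
  by apply/eqP; rewrite eqn_leq (le_rank _ _ _ _ Dpsi) (le_rank _ _ _ _ psiD).
have m0 : forall a b, m (D 0%N a b) by [].
move: (D 0%N) ex0 m0 psi psiD Dpsi; rewrite Er => phi ex0' m0 psi H1 H2.
by exists (r 0%N), s, phi, psi.
Qed.

End AuslanderBuchsbaum.

(** * Hilbert functions *)

Section Hilbert.
Variables (R : comNzRingType) (m : R -> Prop).
Hypothesis Hloc : local_ring m.
Let im := local_ideal Hloc.

(* If [psi j i] is a unit, row [j] of [psi *m phi = g] expresses [g e_j] through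
   the rows of [phi], and [phi i] can be traded for it; the new row lies in [m^2]. *)
Lemma weighted_factorization n (g : R) (phi psi : 'M[R]_n) : ipow m 2 g ->
  (forall i j, m (phi i j)) -> phi *m psi = g%:M -> psi *m phi = g%:M ->
  exists (w : 'I_n -> nat) (phi' psi' : 'M[R]_n),
  [/\ forall i, (0 < w i <= 2)%N,
      forall i j, ipow m (w i) (phi' i j),
      forall i j, ipow m (2 - w i) (psi' j i),
      phi' *m psi' = g%:M &
      forall v : 'rV_n, (exists u, v = u *m phi) <-> (exists u, v = u *m phi')].
Proof.
move=> Hg mphi.
(* [b] marks the rows already known to lie in [m^2]; the number of unmarked rows is the induction
   measure. *)
have : exists b : 'I_n -> bool, forall i j, ipow m (b i).+1 (phi i j).
  by exists (fun=> false) => i j; apply/ipow1.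
case=> b; have [c] := ubnP #|[pred i | ~~ b i]|.
elim: c b phi psi {mphi} => // c IH b phi psi Hc mphi pq qp.
case: (EM (forall i j, ~~ b i -> m (psi j i))) => [mpsi|].
  exists (fun i => (b i).+1), phi, psi; split=> // [i|i j]; first by case: (b i).
  by have := mpsi i j; case: (b i) => // H; apply/ipow1 => //; exact: H.
move=> /existsNP[i /existsNP[j /not_implyP[nbi /(local_unit Hloc)[y Hy]]]].
(* Entry [i] of [rho] is zero because [y] inverts [psi j i], so [X] squares to zero and [1 + X] is
   invertible. Multiplying [phi] by [1 + X] replaces row [i] by [y g e_j] and changes no other
   row. *)
pose rho : 'rV[R]_n := y *: row j psi - delta_mx 0 i.
pose X := delta_mx i 0 *m rho.
have rhoC : rho *m delta_mx i (0 : 'I_1) = 0.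
  by apply/matrixP => a b'; rewrite !ord1 -colE !mxE !eqxx mulrC Hy subrr.
have XX : X *m X = 0 by rewrite mulmxA -[X *m _]mulmxA rhoC mulmx0 mul0mx.
have PQ : (1%:M + X) *m (1%:M - X) = 1%:M.
  by rewrite mulmxDl !mulmxBr !mul1mx mulmx1 XX subr0 subrK.
have QP : (1%:M - X) *m (1%:M + X) = 1%:M.
  by rewrite mulmxBl !mulmxDr !mul1mx mulmx1 XX addr0 addrK.
have rhophi : rho *m phi = y *: row j g%:M - row i phi.
  by rewrite mulmxBl -scalemxAl -row_mul qp -rowE.
have [||||w [phi' [psi' [H1 H2 H3 H4 H5]]]] :=
  IH (fun k => b k || (k == i)) ((1%:M + X) *m phi) (psi *m (1%:M - X)).
- rewrite -ltnS; apply: leq_trans Hc; rewrite ltnS; apply: proper_card.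
  apply/properP; split; last by exists i; rewrite !inE ?nbi // eqxx orbT.
  by apply/subsetP => k; rewrite !inE negb_or => /andP[].
- move=> a b'; rewrite mulmxDl mul1mx -mulmxA rhophi mxE [X in _ + X]mxE big_ord1 !mxE eqxx andbT.
  have [->|ai] := eqVneq a i; last by rewrite mul0r addr0 orbF; exact: mphi.
  rewrite orbT mul1r addrC subrK; apply: idealMl; first exact: ipow_ideal.
  by case: (j == b'); rewrite ?mulr1n ?mulr0n //; case: (ipow_ideal m 2).
- rewrite mulmxA -[_ *m phi *m psi]mulmxA pq -mulmxA mul_scalar_mx -scalemxAr PQ.
  by rewrite scalemx1.
- by rewrite mulmxA -[psi *m _ *m _]mulmxA QP mulmx1 qp.
exists w, phi', psi'; split=> // v; rewrite -H5; split=> -[u ->].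
  by exists (u *m (1%:M - X)); rewrite -mulmxA [_ *m (_ *m phi)]mulmxA QP mul1mx.
by exists (u *m (1%:M + X)); rewrite mulmxA.
Qed.

(** Coordinates are enlarged one at a time: [X j] has its first [j] coordinates in [B] and the
    others in [A], so consecutive quotients are the single [B j / A j]. *)
Lemma qlength_vec n (A B : 'I_n -> R^o -> Prop) (l : 'I_n -> nat) :
  (forall i, qlength (A i) (B i) (l i)) ->
  qlength (fun v : 'rV[R]_n => forall i, A i (v 0 i)) (fun v => forall i, B i (v 0 i))
    (\sum_i l i).
Proof.
move=> Hl.
have sA i : is_ideal (A i) by case: (Hl i) => /subchain_submodule[].
have sB i : is_ideal (B i) by case: (Hl i) => /subchain_submodule[].
have AB i x : A i x -> B i x by case: (Hl i) => /subchain_incl AB _; exact: AB.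
pose C j (i : 'I_n) := if (i < j)%N then B i else A i.
have sC j i : is_ideal (C j i) by rewrite /C; case: ifP.
pose X j (v : 'rV[R]_n) := forall i, C j i (v 0 i).
have sX j : submodule (X j).
  split=> [i|u v Xu Xv i|r v Xv i]; rewrite mxE; first by case: (sC j i).
    exact: idealD (sC j i) (Xu i) (Xv i).
  exact: idealMl (sC j i) (Xv i).
have HX j : (j <= n)%N -> qlength (X 0%N) (X j) (\sum_(i < n | (i < j)%N) l i).
  elim: j => [_|j IH jn]; first by rewrite big_pred0 //; exact: qlength_refl.
  pose j0 := Ordinal jn.
  have -> : (\sum_(i < n | (i < j.+1)%N) l i = \sum_(i < n | (i < j)%N) l i + l j0)%N.
    rewrite (bigD1 j0) //= addnC; congr (_ + _)%N; apply: eq_bigl => i.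
    by rewrite -val_eqE /= ltnS [in RHS]ltn_neqAle andbC.
  apply: qlength_add; first exact/IH/ltnW.
  have Cne i : i != j0 -> C j.+1 i = C j i.
    by rewrite /C ltnS leq_eqVlt -val_eqE => /negPf /= ->.
  have C1 : C j.+1 j0 = B j0 by rewrite /C ltnSn.
  have C0 : C j j0 = A j0 by rewrite /C ltnn.
  have Xsub v : X j v -> X j.+1 v.
    move=> Xv i; have := Xv i; rewrite /C; case: ltnP => [ij|_].
      by rewrite leqW.
    by case: ifP => // _; exact: AB.
  have dE (r : R) i : (r *: delta_mx 0 j0 : 'rV[R]_n) 0 i = if i == j0 then r else 0.
    by rewrite !mxE eqxx /=; case: eqP; rewrite ?mulr1 ?mulr0.
  apply: (@qlength_transport R R^o 'rV[R]_n (fun r => r *: delta_mx 0 j0) (A j0) (B j0)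
    (X j) (X j.+1) _ (sB j0) (sX j) (sX j.+1)) => //.
  - by move=> a u v; rewrite scalerDl scalerA.
  - move=> r Br i; rewrite dE; case: eqP => [->|_]; first by rewrite C1.
    by case: (sC j.+1 i).
  - exact: AB.
  - move=> v Xv; exists (v 0 j0); first by rewrite -C1; exact: Xv.
    move=> i; rewrite mxE [X in _ + X]mxE dE; case: (eqVneq i j0) => [->|ij].
      by rewrite subrr; case: (sC j j0).
    by rewrite subr0 -Cne //; exact: Xv.
  - move=> r Br; split=> [Xr|Ar i]; first by have := Xr j0; rewrite dE eqxx C0.
    by rewrite dE; case: eqP => [->|_]; [rewrite C0|case: (sC j i)].
have -> : (\sum_i l i = \sum_(i < n | (i < n)%N) l i)%N.
  by apply: eq_bigl => i; rewrite ltn_ord.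
have := HX n (leqnn _).
have -> : X n = (fun v : 'rV[R]_n => forall i, B i (v 0 i)); last first.
  suff -> : X 0%N = (fun v : 'rV[R]_n => forall i, A i (v 0 i)) by [].
  by apply: pred_ext.
by apply: pred_ext => v; split=> Hv i; have := Hv i; rewrite /C ltn_ord.
Qed.

(** The order of [c] is raised by one at each use of the hypothesis on [g^*], as long as
    [j + 3 <= N]. For [N < 2] the truncated subtraction makes the claim trivial. *)
Lemma ipow_mul_nzd g N c : initial_form_nzd m g 2 ->
  ipow m N (g * c) -> ipow m (N - 2) c.
Proof.
move=> Hgs Hc; suff H j : (j <= N - 2)%N -> ipow m j c by exact: H.
elim: j => // j IH jN; apply: Hgs; first exact/IH/ltnW.
by apply: ipow_le Hc; rewrite addn2; move: jN; rewrite ltn_subRL addnC addn2.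
Qed.

Lemma initial_form_nzd_regular g c : initial_form_nzd m g 2 -> g * c = 0 -> c = 0.
Proof.
move=> Hgs gc; apply: (krull_intersection Hloc) => n.
rewrite -[n](addnK 2); apply: ipow_mul_nzd Hgs _; rewrite gc.
by case: (ipow_ideal m (n + 2)).
Qed.

(* The [k]-th coefficient of [z^w * sum_n H n z^n]. *)
Definition shiftH (H : nat -> nat) (k w : nat) : nat := if (w <= k)%N then H (k - w)%N else 0%N.

Section Cokernel.
Variables (M : lmodType R) (n : nat) (s : 'I_n -> M) (phi psi : 'M[R]_n) (g : R).
Variables (w : 'I_n -> nat) (H : nat -> nat).
Hypotheses (s_onto : forall y, exists v, y = lincomb s v)
  (ker_s : forall v, lincomb s v = 0 <-> exists u, v = u *m phi)
  (w2 : forall i, (w i <= 2)%N) (Hphi : forall i j, ipow m (w i) (phi i j))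
  (Hpsi : forall i j, ipow m (2 - w i) (psi j i)) (pq : phi *m psi = g%:M)
  (Hgs : initial_form_nzd m g 2)
  (HH : forall k, @qlength R R^o (ipow m k.+1) (ipow m k) (H k)).

Let F k := @vecS R (ipow m k) n.
(** The filtration of the source of [phi] shifted by the weights; truncated subtraction gives the
    whole ring in coordinates with [k < w i]. *)
Let G k (v : 'rV[R]_n) := forall i, ipow m (k - w i) (v 0 i).

Let sF k : submodule (F k).
Proof. exact/submodule_vecS/ipow_ideal. Qed.

Let sG k : submodule (G k).
Proof.
have iI a := ipow_ideal m a.
split=> [i|u v Xu Xv i|r v Xv i]; rewrite mxE; first by case: (iI (k - w i)%N).
  exact: idealD (iI _) (Xu i) (Xv i).
exact: idealMl (iI _) (Xv i).
Qed.

(** The strictness of [phi]. For the converse, multiplying by [psi] puts [g v_i] in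
    [m^(k + 2 - w_i)], and cancelling [g] lowers the exponent by exactly 2. *)
Let phi_G k v : G k v <-> F k (v *m phi).
Proof.
have iI a := ipow_ideal m a; split=> Hv i.
  rewrite mxE; apply: ideal_sum => // j _.
  by apply: ipow_le (ipow_mul (Hv j) (Hphi j i)); rewrite addnC -leq_subLR.
have -> : (k - w i = k + (2 - w i) - 2)%N.
  have := w2 i; case: (w i) => [|[|[|//]]] _; rewrite ?addnK ?subn0 ?addn0 //.
  by rewrite addn1 subSS.
apply: (ipow_mul_nzd Hgs).
have -> : g * v 0 i = (v *m phi *m psi) 0 i by rewrite -mulmxA pq mul_mx_scalar mxE.
rewrite mxE; apply: ideal_sum => // j _; exact: ipow_mul (Hv j) (Hpsi i j).
Qed.

(** The quotient [F k / F (k + 1)] is cut at [N = F (k + 1) + phi (G k)]. The lower part is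
    isomorphic to [G k / G (k + 1)] through [phi], the upper part to [m^k M / m^(k+1) M] through
    [lincomb s]. *)
Lemma hilbert_cokernel k : exists2 l, qlength (powM m k.+1 M) (powM m k M) l &
  (\sum_(i < n) H k = \sum_(i < n) shiftH H k (w i) + l)%N.
Proof.
have FS v : F k.+1 v -> F k v by move=> Fv i; apply/ipowS/Fv.
have lenF : qlength (F k.+1) (F k) (\sum_(i < n) H k).
  by apply: (@qlength_vec n (fun=> ipow m k.+1) (fun=> ipow m k) (fun=> H k)).
have lenG : qlength (G k.+1) (G k) (\sum_(i < n) shiftH H k (w i)).
  apply: (@qlength_vec n (fun i => ipow m (k.+1 - w i)) (fun i => ipow m (k - w i))) => i.
  rewrite /shiftH; case: leqP => [wk|kw]; first by rewrite subSn.
  have -> : (k - w i = 0)%N by apply/eqP; rewrite subn_eq0 ltnW.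
  have -> : (k.+1 - w i = 0)%N by apply/eqP; rewrite subn_eq0.
  exact: qlength_refl.
pose I v := exists2 u, G k u & v = u *m phi.
have sI : submodule I.
  have [G0 GD GZ] := sG k.
  split=> [|_ _ [u Gu ->] [v Gv ->]|r _ [u Gu ->]]; first by exists 0; rewrite ?mul0mx.
    by exists (u + v); rewrite ?mulmxDl //; exact: GD.
  by exists (r *: u); rewrite ?scalemxAl //; exact: GZ.
pose N := sumS (F k.+1) I.
have sN : submodule N by exact: submodule_sumS.
have NF v : N v -> F k v.
  case=> a [_ [Fa [u /phi_G Gu ->] ->]]; have [_ FD _] := sF k.
  by apply: FD => //; exact: FS.
have lenN : qlength (F k.+1) N (\sum_(i < n) shiftH H k (w i)).
  apply: (@qlength_transport R _ _ (mulmxr phi) (G k.+1) (G k)) lenG => //.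
  - by move=> a u v; rewrite linearP.
  - by move=> v Gv; apply: sumSr => //; exists v.
  - by move=> v Fv; exact: sumSl.
  - by move=> v Gv i; apply: ipow_le (Gv i); rewrite leq_sub2r.
  - by move=> _ [a [_ [Fa [u Gu ->] ->]]]; exists u; rewrite //= addrK.
  - by move=> v _; rewrite phi_G.
have [l lenl El] := qlength_sub sN NF lenN lenF.
exists l => //.
have sF_pow j v : F j v -> powM m j M (lincomb s v).
  move=> Fv; apply: submodule_sum => [|i _]; first exact: submodule_span.
  exact: prodM_incl.
have pow_sF j y : powM m j M y -> exists2 v, F j v & y = lincomb s v.
  pose K y := exists2 v, F j v & y = lincomb s v.
  have [F0 FD FZ] := sF j.
  have sK : submodule K.
    split=> [|_ _ [u Fu ->] [v Fv ->]|r _ [u Fu ->]]; first by exists 0; rewrite ?linear0.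
      by exists (u + v); rewrite ?linearD //; exact: FD.
    by exists (r *: u); rewrite ?linearZ //; exact: FZ.
  apply: (prodM_min sK) => r z Hr _; have [v ->] := s_onto z.
  exists (r *: v); rewrite ?linearZ // => i; rewrite mxE.
  exact: idealMr (ipow_ideal _ _) Hr.
apply: (@qlength_transport R _ _ (lincomb s) N (F k)) lenl => //.
- exact: lincomb_is_linear.
- exact: submodule_span.
- exact: submodule_span.
- exact: sF_pow.
- move=> y /pow_sF[v Fv ->]; exact/sF_pow/FS.
- move=> y /pow_sF[v Fv ->]; exists v; rewrite // subrr.
  by case: (@submodule_span R M (fun v => exists r w, [/\ ipow m k.+1 r, True & v = r *: w])).
(* Strictness enters again: a relation [x phi] lying in [F k] must come from some [x] in [G k], so
   it belongs to [N]. *)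
- move=> v Fv; split=> [/pow_sF[u Fu Euv]|[a [_ [Fa [u Gu ->] ->]]]].
    have /ker_s[x Ex] : lincomb s (v - u) = 0 by rewrite linearB /= Euv subrr.
    exists u, (v - u); split=> //; last by rewrite addrC subrK.
    exists x => //.
    by apply/phi_G; rewrite -Ex; apply: (submoduleB (sF k)) => //; exact: FS.
  rewrite linearD /=; have -> : lincomb s (u *m phi) = 0 by apply/ker_s; exists u.
  by rewrite addr0; exact: sF_pow.
Qed.

End Cokernel.
End Hilbert.

(** * Hilbert series handled coefficientwise *)

Section HilbertSeries.

Definition conv (p : {poly int}) (c : nat -> nat) (n : nat) : int :=
  \sum_(k < n.+1) p`_k * (c (n - k)%N)%:Z.

Lemma inv1mz_coef0 d : inv1mz_coef d 0 = 1%N.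
Proof. by case: d => [|d] //=; rewrite binn. Qed.

Lemma inv1mz_coefS d j :
  inv1mz_coef d.+1 j.+1 = (inv1mz_coef d.+1 j + inv1mz_coef d j.+1)%N.
Proof.
case: d => [|d] /=; first by rewrite !bin0.
by rewrite !addSn binS -addSnnS.
Qed.

Lemma conv0 p c : conv p c 0 = p`_0 * (c 0%N)%:Z.
Proof. by rewrite /conv big_ord1. Qed.

Lemma convS p c n : conv p c n.+1 =
  \sum_(k < n.+1) p`_k * (c (n - k).+1)%:Z + p`_n.+1 * (c 0%N)%:Z.
Proof.
rewrite /conv big_ord_recr /= subnn; congr (_ + _); apply: eq_bigr => k _.
by rewrite subSn // -ltnS.
Qed.

Lemma conv_diff0 p d : conv p (inv1mz_coef d.+1) 0 = conv p (inv1mz_coef d) 0.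
Proof. by rewrite !conv0 !inv1mz_coef0. Qed.

(** Multiplication by [1 - z] lowers the pole order by one; on coefficients this is Pascal's
    rule. *)
Lemma conv_diffS p d n :
  conv p (inv1mz_coef d.+1) n.+1 - conv p (inv1mz_coef d.+1) n =
  conv p (inv1mz_coef d) n.+1.
Proof.
rewrite !convS !inv1mz_coef0 addrAC; congr (_ + _).
rewrite /conv -sumrB; apply: eq_bigr => k _.
by rewrite inv1mz_coefS PoszD mulrDr addrC addKr.
Qed.

Lemma convD p q c n : conv (p + q) c n = conv p c n + conv q c n.
Proof. by rewrite -big_split; apply: eq_bigr => k _; rewrite coefD mulrDl. Qed.

Lemma conv_sum I (r : seq I) (P : I -> {poly int}) c n :
  conv (\sum_(i <- r) P i) c n = \sum_(i <- r) conv (P i) c n.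
Proof.
elim: r => [|i r IH]; last by rewrite !big_cons convD IH.
by rewrite !big_nil /conv big1 // => k _; rewrite coef0 mul0r.
Qed.

Lemma convMX0 p c : conv (p * 'X) c 0 = 0.
Proof. by rewrite conv0 coefMX mul0r. Qed.

Lemma convMXS p c n : conv (p * 'X) c n.+1 = conv p c n.
Proof.
rewrite /conv big_ord_recl coefMX mul0r add0r; apply: eq_bigr => k _.
by rewrite coefMX.
Qed.

(** The polynomial [(1 - z^w)/(1 - z)] for the weights 1 and 2. *)
Definition qpoly (w : nat) : {poly int} := if w == 1%N then 1 else 1 + 'X.

Lemma conv_shift (H : nat -> nat) (h : {poly int}) d w k : (0 < w <= 2)%N ->
  (forall n, (H n)%:Z = conv h (inv1mz_coef d.+1) n) ->
  (H k)%:Z - (shiftH H k w)%:Z = conv (h * qpoly w) (inv1mz_coef d) k.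
Proof.
move=> w12 HH.
have H1 j : (H j)%:Z - (shiftH H j 1)%:Z = conv h (inv1mz_coef d) j.
  case: j => [|j]; first by rewrite /shiftH subr0 HH conv_diff0.
  by rewrite /shiftH /= subn1 /= !HH conv_diffS.
case: w w12 => [|[|[|//]]] // _; rewrite /qpoly /= ?mulr1 //.
(* For weight 2 the difference telescopes into the two consecutive differences at [k] and
   [k - 1]. *)
rewrite mulrDr mulr1 convD -H1; case: k => [|k]; first by rewrite convMX0 /shiftH !addr0.
rewrite convMXS -H1 /shiftH /= (_ : (k.+1 - 1 = k)%N) ?subn1 // addrA subrK.
by case: k => [|k] //=; rewrite !subSS !subn0.
Qed.

Lemma horner_qpoly w : (0 < w <= 2)%N -> (qpoly w).[1] = w%:Z.
Proof. case: w => [|[|[|//]]] // _; rewrite /qpoly /=.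
  by rewrite hornerE.
by rewrite !hornerE.
Qed.

End HilbertSeries.

Lemma kdim_uniq (R : comNzRingType) (I : R -> Prop) a b : kdim I a -> kdim I b -> a = b.
Proof. by move=> [Ha amax] [Hb bmax]; apply/eqP; rewrite eqn_leq bmax ?amax. Qed.

Theorem theorem9p2 (R : comNzRingType) (m : R -> Prop) (d e : nat)
  (Hloc : local_ring m)
  (Hinf : infinite_residue m)
  (Hdim : ring_dim R d) (Hd1 : (1 <= d)%N)
  (HCM : depth m R^o d)
  (Hemb : embdim m e) (Hnreg : e <> d)
  (Hmin : multiplicity m R^o (e - d).+1%:Z)
  (g : R) (Hg2 : ipow m 2 g) (Hg3 : ~ ipow m 3 g)
  (Hgstar : initial_form_nzd m g 2)
  (M : lmodType R) (HM : MCM_over_quotient m g M)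
  (Hpd : finite_projdim M) :
  exists e0 : int, multiplicity m M e0 /\ ((e - d).+1%:Z %| e0)%Z.
Proof.
have [dA [H [hA [HdA HH Hser hA1 EhA]]]] := Hmin.
have annR : ann R^o = (fun x => x = 0).
  apply: pred_ext => x; split=> [/(_ 1)|-> v]; last exact: scale0r.
  by rewrite -[x *: 1]/(x * 1) mulr1.
have EdA : dA = d.
  by rewrite /mod_dim annR in HdA; exact: kdim_uniq HdA Hdim.
have {}HH k : @qlength R R^o (ipow m k.+1) (ipow m k) (H k) by rewrite -!powM_regular.
(* From here on [d] stands for [dim A - 1], the dimension to be found for [A/(g)] and [M]. *)
case: d EdA Hd1 Hdim HCM {Hnreg Hmin} EhA => // d EdA _ Hdim HCM EhA; subst dA.
have [gM fM [t [Ht HdM]]] := HM.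
have g_nzd c : g * c = 0 -> c = 0.
  by apply: (initial_form_nzd_regular Hloc Hgstar).
have mg : m g by apply/(ipow1 _ (local_ideal Hloc)); exact: ipowS.
have s0 := submodule_eq0 R^o.
have ng : @nzdmod R R^o (fun x => x = 0) g by [].
have Eg : principal g = colon (@addx R R^o (fun x => x = 0) g).
  apply: pred_ext => x; split=> [[c ->] v|/(_ 1)[_ [c [-> Ex]]]].
    by exists 0, (c * v); split=> //; rewrite add0r -[LHS]/(c * g * v) -[RHS]/(g * (c * v)); ring.
  by exists c; move: Ex; rewrite add0r -[x *: 1]/(x * 1) mulr1 mulrC.
have E0 : colon (fun x : R^o => x = 0) = (fun x => x = 0) by exact: annR.
(* [dim A/(g)] is squeezed: chains of primes over [(g)] extend downwards because [g] is regular,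
   while cutting by [g] costs at most one unit of depth, and depth bounds dimension from below. *)
have td : (t.+1 <= d.+1)%N.
  apply: Hdim.2; rewrite -E0; apply: (prime_chain_below Hloc s0 ng).
  by rewrite -Eg; case: Ht.
have dt : (d <= t)%N.
  apply: Ht.2; rewrite Eg; apply: (dge_prime_chain Hloc); first exact: submodule_addx.
  by apply: (dge_exchange Hloc) => //; [exact: fin_gen_regular|exact: depth_dge].
have {td dt} Et : t = d by apply/eqP; rewrite eqn_leq dt andbT.
subst t.
(* The depth of [M] gives the lower bound; the upper bound holds because the annihilator of [M]
   contains [(g)]. *)
have dimM : mod_dim M d.
  split; first exact: (dge_prime_chain Hloc (submodule_eq0 M)) (depth_dge HdM).
  move=> k [C [HC SC]]; apply: Ht.2; exists C; split=> // i ik.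
  have [pC aC] := HC i ik; split=> // _ [c ->]; apply: aC => v.
  by rewrite -scalerA gM scaler0.
have [n [s [phi0 [psi0 [s_onto ker0 mphi pq0 qp0]]]]] :=
  square_presentation Hloc fM Hpd HCM HdM gM g_nzd.
have [w [phi [psi [w12 Hphi Hpsi pq rowE]]]] :=
  weighted_factorization Hloc Hg2 mphi pq0 qp0.
have ker_s v : lincomb s v = 0 <-> exists u, v = u *m phi by rewrite ker0 rowE.
have w2 i : (w i <= 2)%N by case/andP: (w12 i).
have lenM k := hilbert_cokernel s_onto ker_s w2 Hphi Hpsi pq Hgstar HH k.
pose HMk k := projT1 (cid2 (lenM k)).
pose hM := \sum_(i < n) hA * qpoly (w i).
have hM1 : hM.[1] = hA.[1] * \sum_(i < n) (w i)%:Z.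
  rewrite /hM horner_sum mulr_sumr; apply: eq_bigr => i _.
  by rewrite hornerM horner_qpoly.
exists hM.[1]; split; last by rewrite hM1 -EhA dvdz_mulr.
exists d, HMk, hM; split=> //.
- by move=> k; rewrite /HMk; case: cid2.
- move=> k; rewrite /HMk; case: cid2 => l /= _ El.
  rewrite -/(conv hM _ k) conv_sum.
  have -> : l%:Z = (\sum_(i < n) H k)%:Z - (\sum_(i < n) shiftH H k (w i))%:Z.
    by rewrite El PoszD addrC addKr.
  rewrite !(big_morph Posz PoszD erefl) -sumrB; apply: eq_bigr => i _.
  exact: conv_shift.
- rewrite hM1 mulf_neq0 //.
  (* [M] is nonzero, so [n > 0], and positive weights make their sum nonzero. *)
  have [v nv] := dge_proper (depth_dge HdM).
  case: n s s_onto {ker0 ker_s lenM HMk hM hM1 phi0 psi0 mphi pq0 qp0 phi psi Hphi Hpsi pq rowE w2} w w12 =>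
    [|n] s s_onto w w12.
    by case: nv; have [c ->] := s_onto v; rewrite /lincomb big_ord0.
  rewrite -(big_morph Posz PoszD erefl) big_ord_recl.
  by have /andP[w0 _] := w12 ord0; case: (w ord0) w0.
Qed.
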